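(* Let $\mathcal{C}$ be a strict modular tensor category over $\mathbb{C}$ with twist $\theta$, let $X_i$, $i\in\Gamma$, be a complete set of non-isomorphic simple objects of $\mathcal{C}$, let $d_i=d(X_i)$, and let $\omega_i\in\mathbb{C}$ be defined by $\theta_{X_i}=\omega_i\,\mathrm{id}_{X_i}$. For any $j\in\Gamma$ and positive integer $n$, $$\nu_n(X_j)=\frac{1}{\dim(\mathcal{C})}\sum_{i,k\in\Gamma}N_{ik}^j\,d_id_k\left(\frac{\omega_i}{\omega_k}\right)^n,$$ where $N_{ik}^j=\dim\mathcal{C}(X_i\otimes X_k,X_j)$. In particular, if $N=\exp(\mathcal{C})$, then $$\nu_N(X_j)=\omega_j^Nd_j=\pm d_j.$$
   Context: A modular tensor category (MTC) over $\mathbb{C}$ is a ribbon fusion category over $\mathbb{C}$ (semisimple, finitely many simples up to isomorphism, simple unit $I$, $\mathrm{End}(X)=\mathbb{C}$ for simple $X$) with braiding $c$, twist $\theta$ and its associated spherical pivotal structure $j=u\theta$ ($u$ the Drinfeld isomorphism of $c$), whose $S$-matrix is non-singular. Strict means that the underlying spherical category is strict: the associativity isomorphism, the pivotal structure $j:V\to V^{\vee\vee}$ and the canonical isomorphisms $(V\otimes W)^\vee\to W^\vee\otimes V^\vee$ are identities. The twist satisfies $\theta_{V\otimes W}=(\theta_V\otimes\theta_W)c_{W,V}c_{V,W}$. $V^\vee$ denotes the dual with $\mathrm{ev}_V:V^\vee\otimes V\to I$ and $\mathrm{db}_V:I\to V\otimes V^\vee$; $d(V)=\mathrm{ev}_{V^\vee}\circ\mathrm{db}_V$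 is the pivotal dimension, and $\dim(\mathcal{C})=\sum_{i\in\Gamma}d_i^2$. The $n$-th Frobenius-Schur indicator $\nu_n(V)$ is the ordinary trace of the linear operator $E_V^{(n)}$ on $\mathcal{C}(I,V^{\otimes n})$ given by $E_V^{(n)}(f)=(\mathrm{ev}_V\otimes V^{\otimes(n-1)}\otimes V)\circ(V^\vee\otimes f\otimes V)\circ\mathrm{db}_{V^\vee}$ (using $V^{\vee\vee}=V$). The exponent $\exp(\mathcal{C})$ of a fusion category (in the sense of Etingof) is the least positive integer $N$ such that $(c_{B,A}c_{A,B})^N=\mathrm{id}$ for all objects $A,B$ of the Drinfeld center $Z(\mathcal{C})$, where $c$ is the braiding of $Z(\mathcal{C})$. *)

(* Defs.v *)
From HB Require Import structures.
From mathcomp Require Import all_boot all_order all_algebra.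
From mathcomp Require Import all_classical all_reals.
From mathcomp Require Export complex.

Set Implicit Arguments.
Unset Strict Implicit.
Unset Printing Implicit Defensive.

Import GRing.Theory.
Local Open Scope ring_scope.

Reserved Notation "g ∘ f" (at level 40, left associativity).
Reserved Notation "A ⊗ B" (at level 30, right associativity).
Reserved Notation "f ⊗m g" (at level 30, right associativity).
Reserved Notation "V ^∨" (at level 1, format "V ^∨").

Record linear_category (F : fieldType) := LinearCategory {
  obj :> Type;
  mor : obj -> obj -> vectType F;
  idm : forall A, mor A A;
  mcomp : forall A B C, mor B C -> mor A B -> mor A C;
  compA : forall A B C D (h : mor C D) (g : mor B C) (f : mor A B),
    mcomp h (mcomp g f) = mcomp (mcomp h g) f;
  comp1m : forall A B (f : mor A B), mcomp (idm B) f = f;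
  compm1 : forall A B (f : mor A B), mcomp f (idm A) = f;
  comp_linearr : forall A B C (g : mor B C), linear (fun f : mor A B => mcomp g f);
  comp_linearl : forall A B C (f : mor A B), linear (fun g : mor B C => mcomp g f)
}.

Arguments mor {F l} A B.
Arguments idm {F l} A.
Arguments mcomp {F l A B C} g f.

Notation "g ∘ f" := (mcomp g f).

Section Linear.
Variables (F : fieldType) (C : linear_category F).

Definition inverse_to (A B : C) (f : mor A B) (g : mor B A) : Prop :=
  g ∘ f = idm A /\ f ∘ g = idm B.

Definition is_iso (A B : C) (f : mor A B) : Prop := exists g, inverse_to f g.

Definition minv (A B : C) (f : mor A B) : mor B A :=
  xget 0 [set g | inverse_to f g]%classic.

Lemma invP (A B : C) (f : mor A B) : is_iso f -> inverse_to f (minv f).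
Proof. by case=> g fg; apply: (@xgetPex _ 0 [set h | inverse_to f h]%classic); exists g. Qed.

Definition isomorphic (A B : C) : Prop := exists f : mor A B, is_iso f.

(* The identity of A, seen as a morphism A -> B when the objects A and B are
   equal; "f is an identity morphism" is [is_identity f]. *)
Definition idcast (A B : C) (e : A = B) : mor A B :=
  eq_rect A (fun X => mor A X) (idm A) B e.

Definition is_identity (A B : C) (f : mor A B) : Prop :=
  exists e : A = B, f = idcast e.

Definition is_zero (Z : C) : Prop :=
  forall A : C, (forall f : mor A Z, f = 0) /\ (forall f : mor Z A, f = 0).

Definition mono (A B : C) (f : mor A B) : Prop :=
  forall (T : C) (s t : mor T A), f ∘ s = f ∘ t -> s = t.

Definition epi (A B : C) (f : mor A B) : Prop :=
  forall (T : C) (s t : mor B T), s ∘ f = t ∘ f -> s = t.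

Definition is_kernel (K A B : C) (f : mor A B) (k : mor K A) : Prop :=
  f ∘ k = 0 /\
  forall (T : C) (t : mor T A), f ∘ t = 0 -> exists! s : mor T K, k ∘ s = t.

Definition is_cokernel (A B Q : C) (f : mor A B) (q : mor B Q) : Prop :=
  q ∘ f = 0 /\
  forall (T : C) (t : mor B T), t ∘ f = 0 -> exists! s : mor Q T, s ∘ q = t.

Definition is_direct_sum (n : nat) (X : 'I_n -> C) (S : C) : Prop :=
  exists (inj : forall k, mor (X k) S) (proj : forall k, mor S (X k)),
    [/\ forall k, proj k ∘ inj k = idm (X k),
        forall k l, k != l -> proj k ∘ inj l = 0
      & \sum_k inj k ∘ proj k = idm S].

(* The case n = 0 of the first clause provides a zero object. *)
Definition abelian_category : Prop :=
  [/\ forall (n : nat) (X : 'I_n -> C), exists S, is_direct_sum X S,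
      forall (A B : C) (f : mor A B), exists (K : C) (k : mor K A), is_kernel f k,
      forall (A B : C) (f : mor A B), exists (Q : C) (q : mor B Q), is_cokernel f q,
      forall (K A : C) (k : mor K A), mono k ->
        exists (B : C) (f : mor A B), is_kernel f k
    & forall (B Q : C) (q : mor B Q), epi q ->
        exists (A : C) (f : mor A B), is_cokernel f q].

Definition simple (X : C) : Prop :=
  ~ is_zero X /\
  forall (Y : C) (f : mor Y X), mono f -> is_zero Y \/ is_iso f.

Definition semisimple : Prop :=
  forall A : C, exists (n : nat) (X : 'I_n -> C),
    (forall k, simple (X k)) /\ is_direct_sum X A.

Definition complete_simples (Γ : finType) (X : Γ -> C) : Prop :=
  [/\ forall i, simple (X i),
      forall i j, isomorphic (X i) (X j) -> i = j
    & forall Y, simple Y -> exists i, isomorphic Y (X i)].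

Definition endpow (A : C) (f : mor A A) (n : nat) : mor A A :=
  iter n (mcomp f) (idm A).

End Linear.

Arguments abelian_category {F} C.
Arguments semisimple {F} C.

Record monoidal_category (F : fieldType) := MonoidalCategory {
  mon_cat :> linear_category F;
  tunit : mon_cat;
  tens : mon_cat -> mon_cat -> mon_cat;
  tensm : forall A A' B B' : mon_cat,
    mor A A' -> mor B B' -> mor (tens A B) (tens A' B');
  tensm_linearr : forall (A A' B B' : mon_cat) (f : mor A A'),
    linear (fun g : mor B B' => tensm f g);
  tensm_linearl : forall (A A' B B' : mon_cat) (g : mor B B'),
    linear (fun f : mor A A' => tensm f g);
  tensm1 : forall A B : mon_cat, tensm (idm A) (idm B) = idm (tens A B);
  tensm_comp : forall (A A' A'' B B' B'' : mon_cat)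
      (f' : mor A' A'') (f : mor A A') (g' : mor B' B'') (g : mor B B'),
    tensm (f' ∘ f) (g' ∘ g) = tensm f' g' ∘ tensm f g;
  assoc : forall A B C : mon_cat, mor (tens (tens A B) C) (tens A (tens B C));
  assoc_iso : forall A B C, is_iso (assoc A B C);
  assoc_nat : forall (A A' B B' C C' : mon_cat)
      (f : mor A A') (g : mor B B') (h : mor C C'),
    assoc A' B' C' ∘ tensm (tensm f g) h = tensm f (tensm g h) ∘ assoc A B C;
  lunit : forall A : mon_cat, mor (tens tunit A) A;
  lunit_iso : forall A, is_iso (lunit A);
  lunit_nat : forall (A A' : mon_cat) (f : mor A A'),
    lunit A' ∘ tensm (idm tunit) f = f ∘ lunit A;
  runit : forall A : mon_cat, mor (tens A tunit) A;
  runit_iso : forall A, is_iso (runit A);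
  runit_nat : forall (A A' : mon_cat) (f : mor A A'),
    runit A' ∘ tensm f (idm tunit) = f ∘ runit A;
  pentagon : forall A B C D : mon_cat,
    assoc A B (tens C D) ∘ assoc (tens A B) C D =
    tensm (idm A) (assoc B C D) ∘ assoc A (tens B C) D ∘
      tensm (assoc A B C) (idm D);
  triangle : forall A B : mon_cat,
    tensm (idm A) (lunit B) ∘ assoc A tunit B = tensm (runit A) (idm B)
}.

Arguments tunit {F m}.
Arguments tens {F m} A B.
Arguments tensm {F m A A' B B'} f g.
Arguments assoc {F m} A B C.
Arguments lunit {F m} A.
Arguments runit {F m} A.

Notation "A ⊗ B" := (tens A B).
Notation "f ⊗m g" := (tensm f g).

Section DrinfeldCenter.
Variables (F : fieldType) (C : monoidal_category F).

Record center_object := CenterObject {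
  carrier :> C;
  half_braiding : forall V : C, mor (carrier ⊗ V) (V ⊗ carrier);
  half_braiding_iso : forall V, is_iso (half_braiding V);
  half_braiding_nat : forall (V W : C) (f : mor V W),
    half_braiding W ∘ (idm carrier ⊗m f) = (f ⊗m idm carrier) ∘ half_braiding V;
  half_braiding_tens : forall V W : C,
    assoc V W carrier ∘ half_braiding (V ⊗ W) ∘ assoc carrier V W =
    (idm V ⊗m half_braiding W) ∘ assoc V carrier W ∘
      (half_braiding V ⊗m idm W)
}.

Definition center_braiding (A B : center_object) : mor (A ⊗ B) (B ⊗ A) :=
  half_braiding A B.

(* Morphisms of the center are morphisms of C, with the same identities and
   composition, so the equation below is the one in the center. *)
Definition kills_double_braidings (N : nat) : Prop :=
  forall A B : center_object,
    endpow (center_braiding B A ∘ center_braiding A B) N = idm (A ⊗ B).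

Definition is_exponent (N : nat) : Prop :=
  [/\ (0 < N)%N, kills_double_braidings N
    & forall M : nat, (0 < M)%N -> kills_double_braidings M -> (N <= M)%N].

End DrinfeldCenter.

Arguments is_exponent {F} C N.

Record rigid_category (F : fieldType) := RigidCategory {
  rig_cat :> monoidal_category F;
  dual_obj : rig_cat -> rig_cat;
  ev : forall V : rig_cat, mor (dual_obj V ⊗ V) tunit;
  db : forall V : rig_cat, mor tunit (V ⊗ dual_obj V);
  zigzag : forall V : rig_cat,
    runit V ∘ (idm V ⊗m ev V) ∘ assoc V (dual_obj V) V ∘ (db V ⊗m idm V) ∘
      minv (lunit V) = idm V;
  zigzag_dual : forall V : rig_cat,
    lunit (dual_obj V) ∘ (ev V ⊗m idm (dual_obj V)) ∘
      minv (assoc (dual_obj V) V (dual_obj V)) ∘ (idm (dual_obj V) ⊗m db V) ∘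
      minv (runit (dual_obj V)) = idm (dual_obj V)
}.

Arguments dual_obj {F r} V.
Arguments ev {F r} V.
Arguments db {F r} V.

Notation "V ^∨" := (dual_obj V).

Section Rigid.
Variables (F : fieldType) (C : rigid_category F).

(* (ev_X ⊗ Y) (X^∨ ⊗ d) *)
Definition mate (X Y : C) (d : mor tunit (X ⊗ Y)) : mor (X^∨) Y :=
  lunit Y ∘ (ev X ⊗m idm Y) ∘ minv (assoc (X^∨) X Y) ∘ (idm (X^∨) ⊗m d) ∘
    minv (runit (X^∨)).

Definition dualm (V W : C) (f : mor V W) : mor (W^∨) (V^∨) :=
  mate ((f ⊗m idm (V^∨)) ∘ db V).

(* (V ⊗ db_W ⊗ V^∨) db_V, which exhibits W^∨ ⊗ V^∨ as a dual of V ⊗ W *)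
Definition db_tens (V W : C) : mor tunit ((V ⊗ W) ⊗ (W^∨ ⊗ V^∨)) :=
  minv (assoc V W (W^∨ ⊗ V^∨)) ∘
    (idm V ⊗m
       (assoc W (W^∨) (V^∨) ∘ (db W ⊗m idm (V^∨)) ∘ minv (lunit (V^∨)))) ∘
    db V.

Definition dual_tens (V W : C) : mor ((V ⊗ W)^∨) (W^∨ ⊗ V^∨) :=
  mate (db_tens V W).

(* Semisimple linear categories with simple unit, finitely many simple objects
   and End(X) = F for X simple; rigidity and bilinearity of the tensor product
   are part of the structure of C. *)
Definition fusion : Prop :=
  [/\ abelian_category C,
      semisimple C,
      exists (Γ : finType) (X : Γ -> C), complete_simples X,
      simple (tunit : C)
    & forall X : C, simple X -> \dim {: mor X X} = 1%N].

(* The coordinate of f on id_I, under which End(I) is identified with F. *)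
Definition unit_scalar (f : mor (tunit : C) tunit) : F :=
  coord [tuple idm (tunit : C)] ord0 f.

End Rigid.

Arguments fusion {F} C.

Record braided_category (F : fieldType) := BraidedCategory {
  br_cat :> rigid_category F;
  braid : forall V W : br_cat, mor (V ⊗ W) (W ⊗ V);
  braid_iso : forall V W, is_iso (braid V W);
  braid_nat : forall (V V' W W' : br_cat) (f : mor V V') (g : mor W W'),
    braid V' W' ∘ (f ⊗m g) = (g ⊗m f) ∘ braid V W;
  hexagonr : forall U V W : br_cat,
    assoc V W U ∘ braid U (V ⊗ W) ∘ assoc U V W =
    (idm V ⊗m braid U W) ∘ assoc V U W ∘ (braid U V ⊗m idm W);
  hexagonl : forall U V W : br_cat,
    minv (assoc W U V) ∘ braid (U ⊗ V) W ∘ minv (assoc U V W) =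
    (braid U W ⊗m idm V) ∘ minv (assoc U W V) ∘ (idm U ⊗m braid V W)
}.

Arguments braid {F b} V W.

(* V -> V ⊗ V^∨ ⊗ V^∨∨ -> V^∨ ⊗ V ⊗ V^∨∨ -> V^∨∨ *)
Definition drinfeld_iso (F : fieldType) (C : braided_category F) (V : C) :
    mor V (V^∨^∨) :=
  lunit (V^∨^∨) ∘ ((ev V ∘ braid V (V^∨)) ⊗m idm (V^∨^∨)) ∘
    minv (assoc V (V^∨) (V^∨^∨)) ∘ (idm V ⊗m db (V^∨)) ∘ minv (runit V).

Record ribbon_category (F : fieldType) := RibbonCategory {
  rib_cat :> braided_category F;
  twist : forall V : rib_cat, mor V V;
  twist_iso : forall V, is_iso (twist V);
  twist_nat : forall (V W : rib_cat) (f : mor V W), twist W ∘ f = f ∘ twist V;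
  twist_tens : forall V W : rib_cat,
    twist (V ⊗ W) = (twist V ⊗m twist W) ∘ (braid W V ∘ braid V W);
  twist_dual : forall V : rib_cat, twist (V^∨) = dualm (twist V)
}.

Arguments twist {F r} V.

Definition lin_trace (F : fieldType) (U : vectType F) (E : {linear U -> U}) : F :=
  \sum_(i < \dim {:U}) coord (vbasis {:U}) i (E (vbasis {:U})`_i).

Section Ribbon.
Variables (F : fieldType) (C : ribbon_category F).

Definition pivot (V : C) : mor V (V^∨^∨) := drinfeld_iso V ∘ twist V.

Definition ptr (V : C) (f : mor V V) : F :=
  unit_scalar (ev (V^∨) ∘ ((pivot V ∘ f) ⊗m idm (V^∨)) ∘ db V).

Definition pdim (V : C) : F := ptr (idm V).

Definition global_dim (Γ : finType) (X : Γ -> C) : F :=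
  \sum_i pdim (X i) ^+ 2.

Definition S_matrix (Γ : finType) (X : Γ -> C) : 'M[F]_#|Γ| :=
  \matrix_(i, j) ptr (braid (X (enum_val j)) (X (enum_val i)) ∘
                      braid (X (enum_val i)) (X (enum_val j))).

Definition modular : Prop :=
  fusion C /\
  forall (Γ : finType) (X : Γ -> C), complete_simples X -> S_matrix X \in unitmx.

Definition strict_category : Prop :=
  [/\ forall U V W : C, is_identity (assoc U V W),
      forall V : C, is_identity (lunit V) /\ is_identity (runit V),
      forall V : C, is_identity (pivot V)
    & forall V W : C, is_identity (dual_tens V W)].

Fixpoint tpow (V : C) (n : nat) : C := if n is m.+1 then V ⊗ tpow V m else tunit.

(* The canonical isomorphism from V^{⊗n} ⊗ V to V ⊗ V^{⊗n} = V^{⊗(n+1)}, built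
   from associativity and unit isomorphisms only. *)
Fixpoint tpow_shift (V : C) (n : nat) : mor (tpow V n ⊗ V) (V ⊗ tpow V n) :=
  match n with
  | 0 => minv (runit V) ∘ lunit V
  | m.+1 => (idm V ⊗m tpow_shift V m) ∘ assoc V (tpow V m) V
  end.

(* E_V^{(n+1)} f = (ev_V ⊗ V^{⊗n} ⊗ V) (V^∨ ⊗ f ⊗ V) db_{V^∨}, with all the
   structural isomorphisms (which are identities in the strict case) spelled
   out. *)
Definition FS_operator (V : C) (n : nat) (f : mor tunit (tpow V n.+1)) :
    mor tunit (tpow V n.+1) :=
  tpow_shift V n ∘
    ((lunit (tpow V n) ∘ (ev V ⊗m idm (tpow V n)) ∘
        minv (assoc (V^∨) V (tpow V n))) ⊗m idm V) ∘
    ((idm (V^∨) ⊗m f) ⊗m idm V) ∘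
    (minv (runit (V^∨)) ⊗m minv (pivot V)) ∘
    db (V^∨).

Lemma FS_operator_linear (V : C) (n : nat) : linear (@FS_operator V n).
Proof.
move=> a f g; rewrite /FS_operator.
by rewrite tensm_linearr tensm_linearl comp_linearr !comp_linearl.
Qed.

HB.instance Definition _ (V : C) (n : nat) :=
  GRing.isLinear.Build F _ _ _ (@FS_operator V n) (@FS_operator_linear V n).

(* The indicator ν_n(V), for n > 0; the value at n = 0 is irrelevant. *)
Definition FS_indicator (V : C) (n : nat) : F :=
  if n is m.+1 then lin_trace (@FS_operator V m) else 0.

End Ribbon.

Arguments modular {F} C.
Arguments strict_category {F} C.

(* Main.v *)
(* Rotation on C(I, V^{⊗n}) is composition with the braid
   B = c_{V,V^{⊗(n-1)}} (θ_V ⊗ id), because db_{V^∨} = (V^∨ ⊗ θ_V) c_{V,V^∨} db_V.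
   A loop coloured by Σ d_i X_i around W = V^{⊗n} is dim(C) times the projection
   onto the unit isotypic part of W, so with D the double braiding
     dim(C) Tr(B | C(I, W)) = Σ_i d_i tr((X_i ⊗ B) D_{X_i,W}).
   The n strands of W closed by B form an unknot winding n times around the
   loop; removing them one at a time (Markov moves) yields
     tr((X_i ⊗ B) D_{X_i,W}) = tr(((X_i ⊗ θ_V) D_{X_i,V})^n),
   and (X_i ⊗ θ_V) D_{X_i,V} is θ_{X_i ⊗ V} / ω_i, which acts on the
   X_k-isotypic part of X_i ⊗ V by ω_k / ω_i.  Exchanging i with its dual gives
   the formula.  When double braidings have order dividing N, balancing gives
   ω_j^N = ω_i^N ω_k^N if N_{ik}^j ≠ 0, and ω_i^{2N} = 1 from ev : X_i^∨ ⊗ X_i -> I,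
   so that the sum collapses to ω_j^N d_j dim(C). *)

From HB Require Import structures.
Require Import Defs.
From mathcomp Require Import all_boot all_order all_algebra.
From mathcomp Require Import all_classical all_reals.

Set Implicit Arguments.
Unset Strict Implicit.
Unset Printing Implicit Defensive.

Import GRing.Theory.
Local Open Scope ring_scope.
Local Open Scope complex_scope.

Reserved Notation "g • f" (at level 40, left associativity).
Reserved Notation "f ⊠ g" (at level 30, right associativity).

(** * Maps that are linear by a proof of [linear] rather than by a structure *)

Lemma linear_zero (F : fieldType) (U V : lmodType F) (f : U -> V) :
  linear f -> f 0 = 0.
Proof.
by move=> fl; have := fl (-1) 0 0; rewrite scaler0 addr0 scaleN1r addNr.
Qed.

Lemma linear_scale (F : fieldType) (U V : lmodType F) (f : U -> V) a u :
  linear f -> f (a *: u) = a *: f u.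
Proof.
by move=> fl; have := fl a u 0; rewrite (linear_zero fl) !addr0.
Qed.

Lemma linear_add (F : fieldType) (U V : lmodType F) (f : U -> V) u v :
  linear f -> f (u + v) = f u + f v.
Proof. by move=> fl; have := fl 1 u v; rewrite !scale1r. Qed.

Lemma linear_bigsum (F : fieldType) (U V : lmodType F) (f : U -> V) (I : Type)
    (r : seq I) (P : pred I) (u : I -> U) :
  linear f -> f (\sum_(i <- r | P i) u i) = \sum_(i <- r | P i) f (u i).
Proof.
move=> fl; apply: (big_morph f); last exact: linear_zero.
by move=> x y; apply: linear_add.
Qed.

(** * Untyped arrows *)

Section Arrows.
Variables (F : fieldType) (C : linear_category F).

(* In a strict category U ⊗ (V ⊗ W) and (U ⊗ V) ⊗ W are equal objects but not
   convertible ones.  Bundling a morphism with its source and target, with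
   [None] for an ill-typed composite, turns the coherence isomorphisms into
   Leibniz equalities that can be used for rewriting. *)
Definition arrow := option {P : C * C & mor P.1 P.2}.

Definition arr (A B : C) (f : mor A B) : arrow :=
  Some (existT (fun P : C * C => mor P.1 P.2) (A, B) f).

Definition typed (x : arrow) (A B : C) : Prop := exists f : mor A B, x = arr f.

Definition acomp (x y : arrow) : arrow :=
  match x, y with
  | Some (existT (B', D) g), Some (existT (A, B) f) =>
    match pselect (B = B') with
    | left e => arr (g ∘ eq_rect B (fun Z => mor A Z) f B' e)
    | right _ => None
    end
  | _, _ => None
  end.

Definition ascale (a : F) (x : arrow) : arrow :=
  if x is Some (existT (A, B) f) then arr (a *: (f : mor A B)) else None.

Definition aid (A : C) : arrow := arr (idm A).

(** Equality of dependent pairs does not project directly; the explicit retraction [coe], which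
    casts along a classically decided equality of endpoints, does. *)
Lemma arr_inj (A B : C) (f g : mor A B) : arr f = arr g -> f = g.
Proof.
pose coe (x : arrow) : mor A B :=
  if x is Some (existT P h) then
    if pselect (P = (A, B)) is left e
    then eq_rect P (fun Q : C * C => mor Q.1 Q.2) h (A, B) e else 0
  else 0.
have coeK h : coe (arr h) = h.
  rewrite /coe /arr; case: pselect => // e.
  by rewrite (Prop_irrelevance e erefl).
by move=> e; rewrite -(coeK f) e coeK.
Qed.

Lemma acompE (A B D : C) (g : mor B D) (f : mor A B) :
  acomp (arr g) (arr f) = arr (g ∘ f).
Proof.
rewrite /acomp /=; case: pselect => // e.
by rewrite (Prop_irrelevance e erefl).
Qed.

Lemma acompNone (x : arrow) : acomp x None = None.
Proof. by case: x => [[[A B] f]|]. Qed.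

Lemma acomp_neq (A B B' D : C) (g : mor B' D) (f : mor A B) :
  B <> B' -> acomp (arr g) (arr f) = None.
Proof. by rewrite /acomp /=; case: pselect. Qed.

(** If a middle object mismatches, both sides are [None]; otherwise this is associativity in [C]. *)
Lemma acompA (x y z : arrow) : acomp x (acomp y z) = acomp (acomp x y) z.
Proof.
case: x => [[[A1 B1] f1]|] //; case: y => [[[A2 B2] f2]|] //;
  case: z => [[[A3 B3] f3]|]; rewrite ?acompNone //.
rewrite -!/(arr _).
have [e|ne] := pselect (B3 = A2); last first.
  rewrite acomp_neq // acompNone.
  have [e|ne'] := pselect (B2 = A1); last by rewrite acomp_neq.
  by case: _ / e f1 => f1; rewrite acompE acomp_neq.
case: _ / e f2 => f2; rewrite acompE.
have [e|ne'] := pselect (B2 = A1); last by rewrite !acomp_neq.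
by case: _ / e f1 => f1; rewrite !acompE Defs.compA.
Qed.

Lemma typed_arr (A B : C) (f : mor A B) : typed (arr f) A B.
Proof. by exists f. Qed.

Lemma typed_comp (A B D : C) (x y : arrow) :
  typed x B D -> typed y A B -> typed (acomp x y) A D.
Proof. by case=> g -> [f ->]; rewrite acompE; exists (g ∘ f). Qed.

Lemma acomp1l (A B : C) (x : arrow) : typed x A B -> acomp (aid B) x = x.
Proof. by case=> f ->; rewrite acompE comp1m. Qed.

Lemma acomp1r (A B : C) (x : arrow) : typed x A B -> acomp x (aid A) = x.
Proof. by case=> f ->; rewrite acompE compm1. Qed.

Lemma ascaleE (a : F) (A B : C) (f : mor A B) : ascale a (arr f) = arr (a *: f).
Proof. by []. Qed.

Lemma compZl (A B D : C) (a : F) (g : mor B D) (f : mor A B) :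
  (a *: g) ∘ f = a *: (g ∘ f).
Proof. exact: (linear_scale _ _ (@comp_linearl _ _ _ _ _ f)). Qed.

Lemma compZr (A B D : C) (a : F) (g : mor B D) (f : mor A B) :
  g ∘ (a *: f) = a *: (g ∘ f).
Proof. exact: (linear_scale _ _ (@comp_linearr _ _ _ _ _ g)). Qed.

Lemma acompZl (a : F) (x y : arrow) : acomp (ascale a x) y = ascale a (acomp x y).
Proof.
case: x => [[[A1 B1] f1]|] //; case: y => [[[A2 B2] f2]|]; rewrite ?acompNone //.
rewrite -!/(arr _) ascaleE.
have [e|ne] := pselect (B2 = A1); last by rewrite !acomp_neq.
by case: _ / e f1 => f1; rewrite !acompE ascaleE compZl.
Qed.

Lemma acompZr (a : F) (x y : arrow) : acomp x (ascale a y) = ascale a (acomp x y).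
Proof.
case: x => [[[A1 B1] f1]|] //; case: y => [[[A2 B2] f2]|]; rewrite ?acompNone //.
rewrite -!/(arr _) ascaleE.
have [e|ne] := pselect (B2 = A1); last by rewrite !acomp_neq.
by case: _ / e f1 => f1; rewrite !acompE ascaleE compZr.
Qed.

Lemma arr_idcast (A B : C) (e : A = B) : arr (idcast e) = aid A.
Proof. by case: _ / e. Qed.

Lemma is_identityP (A B : C) (f : mor A B) : is_identity f -> A = B /\ arr f = aid A.
Proof. by case=> e ->; split=> //; rewrite arr_idcast. Qed.

Lemma is_identity_minv (A B : C) (f : mor A B) :
  is_identity f -> arr (minv f) = aid B.
Proof.
case=> e ->; case: _ / e.
have /invP [h _] : is_iso (idm A) by exists (idm A); split; rewrite comp1m.
by rewrite compm1 in h; rewrite /= h.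
Qed.

End Arrows.

Arguments aid {F C} A.
Arguments acomp {F C} x y : simpl never.
Notation "x • y" := (acomp x y).

Section Tensor.
Variables (F : fieldType) (C : monoidal_category F).

Definition atens (x y : arrow C) : arrow C :=
  match x, y with
  | Some (existT (A, B) f), Some (existT (A', B') g) =>
      arr ((f : mor A B) ⊗m (g : mor A' B'))
  | _, _ => None
  end.

Local Notation "x ⊠ y" := (atens x y).

Lemma atensE (A B A' B' : C) (f : mor A B) (g : mor A' B') :
  arr f ⊠ arr g = arr (f ⊗m g).
Proof. by []. Qed.

Lemma atensNone (x : arrow C) : x ⊠ None = None.
Proof. by case: x => [[[A B] f]|]. Qed.

Lemma aid_tens (A B : C) : aid A ⊠ aid B = aid (A ⊗ B).
Proof. by rewrite atensE tensm1. Qed.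

Lemma typed_tens (A B A' B' : C) (x y : arrow C) :
  typed x A B -> typed y A' B' -> typed (x ⊠ y) (A ⊗ A') (B ⊗ B').
Proof. by case=> f -> [g ->]; exists (f ⊗m g). Qed.

Lemma atens_comp (A B D A' B' D' : C) (x x' y y' : arrow C) :
  typed x A B -> typed x' B D -> typed y A' B' -> typed y' B' D' ->
  (x' • x) ⊠ (y' • y) = (x' ⊠ y') • (x ⊠ y).
Proof.
move=> [f ->] [f' ->] [g ->] [g' ->].
by rewrite !acompE atensE tensm_comp.
Qed.

Lemma tensZl (A B A' B' : C) (a : F) (f : mor A B) (g : mor A' B') :
  (a *: f) ⊗m g = a *: (f ⊗m g).
Proof. exact: (linear_scale _ _ (@tensm_linearl _ _ _ _ _ _ g)). Qed.

Lemma tensZr (A B A' B' : C) (a : F) (f : mor A B) (g : mor A' B') :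
  f ⊗m (a *: g) = a *: (f ⊗m g).
Proof. exact: (linear_scale _ _ (@tensm_linearr _ _ _ _ _ _ f)). Qed.

Lemma atensZl (a : F) (x y : arrow C) : ascale a x ⊠ y = ascale a (x ⊠ y).
Proof.
case: x => [[[A1 B1] f1]|] //; case: y => [[[A2 B2] f2]|] //.
by rewrite -!/(arr _) ascaleE !atensE tensZl.
Qed.

Lemma atensZr (a : F) (x y : arrow C) : x ⊠ ascale a y = ascale a (x ⊠ y).
Proof.
case: x => [[[A1 B1] f1]|] //; case: y => [[[A2 B2] f2]|] //.
by rewrite -!/(arr _) ascaleE !atensE tensZr.
Qed.

Lemma atens_compl (A B D : C) (P : C) (x y : arrow C) :
  typed y A B -> typed x B D -> aid P ⊠ (x • y) = (aid P ⊠ x) • (aid P ⊠ y).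
Proof.
move=> ty tx; rewrite -(atens_comp (typed_arr (idm P)) (typed_arr (idm P)) ty tx).
by rewrite (acomp1l (typed_arr (idm P))).
Qed.

Lemma atens_compr (A B D : C) (P : C) (x y : arrow C) :
  typed y A B -> typed x B D -> (x • y) ⊠ aid P = (x ⊠ aid P) • (y ⊠ aid P).
Proof.
move=> ty tx; rewrite -(atens_comp ty tx (typed_arr (idm P)) (typed_arr (idm P))).
by rewrite (acomp1l (typed_arr (idm P))).
Qed.

Lemma atens_exchl (A B A' B' : C) (x y : arrow C) :
  typed x A B -> typed y A' B' -> x ⊠ y = (x ⊠ aid B') • (aid A ⊠ y).
Proof.
move=> tx ty; rewrite -(atens_comp (typed_arr _) tx ty (typed_arr _)).
by rewrite (acomp1r tx) (acomp1l ty).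
Qed.

Lemma atens_exchr (A B A' B' : C) (x y : arrow C) :
  typed x A B -> typed y A' B' -> x ⊠ y = (aid B ⊠ y) • (x ⊠ aid A').
Proof.
move=> tx ty; rewrite -(atens_comp tx (typed_arr _) (typed_arr _) ty).
by rewrite (acomp1l tx) (acomp1r ty).
Qed.

Lemma atens_exch (A B A' B' : C) (x y : arrow C) :
  typed x A B -> typed y A' B' ->
  (x ⊠ aid B') • (aid A ⊠ y) = (aid B ⊠ y) • (x ⊠ aid A').
Proof. by move=> tx ty; rewrite -(atens_exchl tx ty) -(atens_exchr tx ty). Qed.

Hypothesis strict_assoc : forall U V W : C, is_identity (assoc U V W).
Hypothesis strict_unit :
  forall V : C, is_identity (lunit V) /\ is_identity (runit V).

Lemma otensA (U V W : C) : (U ⊗ V) ⊗ W = U ⊗ (V ⊗ W).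
Proof. by have [] := is_identityP (strict_assoc U V W). Qed.

Lemma arr_assoc (U V W : C) : arr (assoc U V W) = aid (U ⊗ (V ⊗ W)).
Proof. by have [e ->] := is_identityP (strict_assoc U V W); rewrite -e. Qed.

Lemma otens1l (V : C) : tunit ⊗ V = V.
Proof. by have [/is_identityP []] := strict_unit V. Qed.

Lemma otens1r (V : C) : V ⊗ tunit = V.
Proof. by have [_ /is_identityP []] := strict_unit V. Qed.

Lemma arr_lunit (V : C) : arr (lunit V) = aid V.
Proof. by have [/is_identityP [e ->]] := strict_unit V; rewrite otens1l. Qed.

Lemma arr_runit (V : C) : arr (runit V) = aid V.
Proof. by have [_ /is_identityP [e ->]] := strict_unit V; rewrite otens1r. Qed.

Lemma typed_cast (A B A' B' : C) (x : arrow C) :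
  typed x A B -> A = A' -> B = B' -> typed x A' B'.
Proof. by move=> h <- <-. Qed.

(** Naturality of the associator, whose components are identity arrows. *)
Lemma atensA (x y z : arrow C) : (x ⊠ y) ⊠ z = x ⊠ (y ⊠ z).
Proof.
case: x => [[[A1 B1] f1]|] //; case: y => [[[A2 B2] f2]|] //;
  case: z => [[[A3 B3] f3]|]; rewrite ?atensNone //.
rewrite -!/(arr _).
have e := assoc_nat f1 f2 f3.
have {e} := congr1 (@arr _ _ _ _) e; rewrite -!acompE !arr_assoc -!atensE.
have t1 : typed ((arr f1 ⊠ arr f2) ⊠ arr f3) (A1 ⊗ A2 ⊗ A3) (B1 ⊗ B2 ⊗ B3).
  by apply: typed_cast; [do !apply: typed_tens; exact: typed_arr | rewrite otensA ..].
have t2 : typed (arr f1 ⊠ arr f2 ⊠ arr f3) (A1 ⊗ A2 ⊗ A3) (B1 ⊗ B2 ⊗ B3).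
  by do !apply: typed_tens; exact: typed_arr.
by rewrite (acomp1l t1) (acomp1r t2).
Qed.

Lemma atens1l (x : arrow C) : aid tunit ⊠ x = x.
Proof.
case: x => [[[A B] f]|] //; rewrite -!/(arr _).
have := congr1 (@arr _ _ _ _) (lunit_nat f); rewrite -!acompE !arr_lunit -atensE.
rewrite (acomp1r (typed_arr f)) (@acomp1l _ _ A) //.
by apply: typed_cast; [apply: typed_tens; exact: typed_arr | rewrite otens1l ..].
Qed.

Lemma atens1r (x : arrow C) : x ⊠ aid tunit = x.
Proof.
case: x => [[[A B] f]|] //; rewrite -!/(arr _).
have := congr1 (@arr _ _ _ _) (runit_nat f); rewrite -!acompE !arr_runit -atensE.
rewrite (acomp1r (typed_arr f)) (@acomp1l _ _ A) //.
by apply: typed_cast; [apply: typed_tens; exact: typed_arr | rewrite otens1r ..].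
Qed.

End Tensor.

Arguments atens {F C} x y : simpl never.
Notation "x ⊠ y" := (atens x y).

Lemma typed_comp_eq (F : fieldType) (C : linear_category F) (A B B' D : C)
    (x y : arrow C) :
  typed x B' D -> typed y A B -> B = B' -> typed (x • y) A D.
Proof. by move=> tx ty e; apply: typed_comp tx _; rewrite -e. Qed.

(** A typed composite is not [None], so its factors share a middle object; distributing a tensor
    over a composite then asks for a typing of the composite only. *)
Lemma typed_comp_inv (F : fieldType) (C : linear_category F) (A D : C)
    (x y : arrow C) :
  typed (x • y) A D -> exists B, typed x B D /\ typed y A B.
Proof.
case: x => [[[A1 B1] f]|]; last by case.
case: y => [[[A2 B2] g]|]; last by rewrite acompNone; case.
rewrite -!/(arr _); have [e|ne] := pselect (B2 = A1); last first.
  by rewrite acomp_neq //; case.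
case: _ / e f => f; rewrite acompE => -[h e]; have [eA eB] : A2 = A /\ B1 = D by case: e.
rewrite -eA -eB; eexists; split; apply: typed_arr.
Qed.

Lemma atens_distrl (F : fieldType) (C : monoidal_category F) (P : C) (x y : arrow C) :
  (exists A D, typed (x • y) A D) -> aid P ⊠ (x • y) = (aid P ⊠ x) • (aid P ⊠ y).
Proof.
by move=> [A [D /typed_comp_inv [B [tx ty]]]]; apply: atens_compl ty tx.
Qed.

Lemma atens_distrr (F : fieldType) (C : monoidal_category F) (P : C) (x y : arrow C) :
  (exists A D, typed (x • y) A D) -> (x • y) ⊠ aid P = (x ⊠ aid P) • (y ⊠ aid P).
Proof.
by move=> [A [D /typed_comp_inv [B [tx ty]]]]; apply: atens_compr ty tx.
Qed.

Section Rewriting.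
Variables (F : fieldType) (C : linear_category F).
Implicit Types w x y z t u : arrow C.

(** In the left-associated composite [w • x • y] the term [x • y] does not occur; these variants
    make the equation applicable there. *)
Lemma acomp_rw2 x y z : x • y = z -> forall w, w • x • y = w • z.
Proof. by move=> <- w; rewrite !acompA. Qed.

Lemma acomp_rw3 x y t z : x • y • t = z -> forall w, w • x • y • t = w • z.
Proof. by move=> <- w; rewrite !acompA. Qed.

Lemma acomp_rw4 x y t u z : x • y • t • u = z -> forall w, w • x • y • t • u = w • z.
Proof. by move=> <- w; rewrite !acompA. Qed.

End Rewriting.

(** * Graphical calculus in a strict ribbon category *)

Section StrictRibbon.
Variables (F : fieldType) (C : ribbon_category F).
Hypothesis sC : strict_category C.

Let sA : forall U V W : C, is_identity (assoc U V W).
Proof. by case: sC. Qed.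
Let s1 : forall V : C, is_identity (lunit V) /\ is_identity (runit V).
Proof. by case: sC. Qed.
Let sp : forall V : C, is_identity (pivot V).
Proof. by case: sC. Qed.
Let st : forall V W : C, is_identity (dual_tens V W).
Proof. by case: sC. Qed.

Lemma odual_dual (V : C) : V^∨^∨ = V.
Proof. by have [] := is_identityP (sp V). Qed.

Lemma odual_tens (V W : C) : (V ⊗ W)^∨ = W^∨ ⊗ V^∨.
Proof. by have [] := is_identityP (st V W). Qed.

Definition strict_objE := (otensA sA, otens1l s1, otens1r s1, odual_tens, odual_dual).

Definition aev (V : C) : arrow C := arr (ev V).
Definition adb (V : C) : arrow C := arr (db V).
Definition abr (V W : C) : arrow C := arr (braid V W).
Definition abri (V W : C) : arrow C := arr (minv (braid V W)).
Definition atw (V : C) : arrow C := arr (twist V).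

Lemma typed_aid (V : C) : typed (aid V) V V. Proof. exact: typed_arr. Qed.
Lemma typed_aev (V : C) : typed (aev V) (V^∨ ⊗ V) tunit.
Proof. exact: typed_arr. Qed.
Lemma typed_adb (V : C) : typed (adb V) tunit (V ⊗ V^∨).
Proof. exact: typed_arr. Qed.
Lemma typed_abr (V W : C) : typed (abr V W) (V ⊗ W) (W ⊗ V).
Proof. exact: typed_arr. Qed.
Lemma typed_abri (V W : C) : typed (abri V W) (W ⊗ V) (V ⊗ W).
Proof. exact: typed_arr. Qed.
Lemma typed_atw (V : C) : typed (atw V) V V. Proof. exact: typed_arr. Qed.

Ltac ty_infer :=
  lazymatch goal with
  | |- typed (_ • _) _ _ => eapply typed_comp_eq; [ty_infer | ty_infer | by rewrite ?strict_objE]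
  | |- typed (_ ⊠ _) _ _ => eapply typed_tens; [ty_infer | ty_infer]
  | |- typed (aid _) _ _ => eapply typed_aid
  | |- typed (aev _) _ _ => eapply typed_aev
  | |- typed (adb _) _ _ => eapply typed_adb
  | |- typed (abr _ _) _ _ => eapply typed_abr
  | |- typed (abri _ _) _ _ => eapply typed_abri
  | |- typed (atw _) _ _ => eapply typed_atw
  | |- typed (arr _) _ _ => eapply typed_arr
  | |- typed _ _ _ => eassumption
  end.
(* Proves [typed x A B], comparing objects up to the strictness equalities. *)
Ltac ty := eapply typed_cast; [ty_infer | by rewrite ?strict_objE | by rewrite ?strict_objE].

Lemma acomp_aidl (B : C) (x : arrow C) : (exists A, typed x A B) -> aid B • x = x.
Proof. by case=> A; apply: acomp1l. Qed.

Lemma acomp_aidr (A : C) (x : arrow C) : (exists B, typed x A B) -> x • aid A = x.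
Proof. by case=> B; apply: acomp1r. Qed.

Ltac ety := eexists; ty.
Ltac ety2 := eexists; eexists; ty.

Definition strict_tensE := (atensA sA, atens1l s1, atens1r s1).

Lemma arr_minv_assoc (U V W : C) : arr (minv (assoc U V W)) = aid (U ⊗ (V ⊗ W)).
Proof. by rewrite is_identity_minv. Qed.
Lemma arr_minv_lunit (V : C) : arr (minv (lunit V)) = aid V.
Proof. by rewrite is_identity_minv //; case: (s1 V). Qed.
Lemma arr_minv_runit (V : C) : arr (minv (runit V)) = aid V.
Proof. by rewrite is_identity_minv //; case: (s1 V). Qed.

Definition coherenceE := (arr_assoc sA, arr_lunit s1, arr_runit s1, arr_minv_assoc,
  arr_minv_lunit, arr_minv_runit).

(* Normal form: a left-associated composite of layers, each a right-associated
   tensor product of generators and identities of non-product objects. *)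
Ltac spread :=
  rewrite ?strict_tensE ?aid_tens;
  repeat first [rewrite atens_distrl; last by ety2 | rewrite atens_distrr; last by ety2];
  rewrite ?acompA ?strict_tensE -?aid_tens ?strict_tensE.

Ltac noid :=
  rewrite ?strict_tensE ?aid_tens;
  repeat first [rewrite acomp_aidl; last by ety | rewrite acomp_aidr; last by ety];
  rewrite ?acompA ?strict_tensE -?aid_tens ?strict_tensE.
(* [exch]: the interchange law; [whisk]: the equation [P ⊠ e ⊠ Q]. *)
Ltac exch h tx ty :=
  move: (atens_exch tx ty); spread; move=> h.
Ltac whisk h P Q e :=
  move: (congr1 (fun x => P ⊠ (x ⊠ Q)) e); lazy beta; spread; move=> h.
(* Rewrites with [h : x • y = z] inside a left-associated composite. *)
Ltac rw h :=
  first [rewrite h | rewrite (acomp_rw2 h) | rewrite (acomp_rw3 h) | rewrite (acomp_rw4 h)];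
  rewrite ?acompA.
Let aI := aid (tunit : C).

(** * Cups, caps and transposes *)

Lemma ev_db_zigzag (V : C) : (aid V ⊠ aev V) • (adb V ⊠ aid V) = aid V.
Proof.
have := congr1 (@arr _ _ _ _) (zigzag V).
rewrite -!acompE -!atensE !coherenceE -/(aid _) -/(aev _) -/(adb _).
rewrite acomp_aidl; last by ety.
rewrite !acomp_aidr //; by ety.
Qed.

Lemma ev_db_zigzag_dual (V : C) : (aev V ⊠ aid V^∨) • (aid V^∨ ⊠ adb V) = aid V^∨.
Proof.
have := congr1 (@arr _ _ _ _) (zigzag_dual V).
rewrite -!acompE -!atensE !coherenceE -/(aid _) -/(aev _) -/(adb _).
rewrite acomp_aidl; last by ety.
rewrite !acomp_aidr //; by ety.
Qed.

Lemma arr_mate (X Y : C) (d : mor tunit (X ⊗ Y)) :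
  arr (mate d) = (aev X ⊠ aid Y) • (aid X^∨ ⊠ arr d).
Proof.
rewrite /mate -!acompE -!atensE !coherenceE -/(aid _) -/(aev _).
rewrite acomp_aidl; last by ety.
rewrite !acomp_aidr //; by ety.
Qed.

(* From [(ev ⊗ Y) (X^∨ ⊗ d) = id] the zigzag identity recovers [d]. *)
Lemma db_unique (X Y : C) (d : arrow C) : typed d tunit (X ⊗ Y) -> Y = X^∨ ->
  (aev X ⊠ aid Y) • (aid X^∨ ⊠ d) = aid Y -> d = adb X.
Proof.
move=> td e h; rewrite e in h td.
have -> : adb X = (aid X ⊠ ((aev X ⊠ aid X^∨) • (aid X^∨ ⊠ d))) • adb X.
  rewrite h aid_tens acomp_aidl //; by ety.
rewrite (@atens_compl _ _ X^∨ (X^∨ ⊗ X ⊗ X^∨) X^∨); try by ty.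
rewrite -acompA.
have := atens_exch (typed_adb X) td; rewrite ?strict_tensE -?aid_tens ?strict_tensE => <-.
rewrite acompA -!(atensA sA) -(@atens_compr _ _ X (X ⊗ X^∨ ⊗ X) X); try by ty.
rewrite ev_db_zigzag aid_tens acomp_aidl //; by ety.
Qed.

Lemma ev_unique (X Y : C) (e : arrow C) : typed e (Y ⊗ X) tunit -> Y = X^∨ ->
  (e ⊠ aid X^∨) • (aid Y ⊠ adb X) = aid Y -> e = aev X.
Proof.
move=> te eY h; rewrite eY in h te.
have -> : aev X = aev X • (((e ⊠ aid X^∨) • (aid X^∨ ⊠ adb X)) ⊠ aid X).
  rewrite h aid_tens acomp_aidr //; by ety.
rewrite (@atens_compr _ _ X^∨ (X^∨ ⊗ X ⊗ X^∨) X^∨); try by ty.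
have := atens_exch te (typed_aev X); rewrite ?strict_tensE -?aid_tens ?strict_tensE => h2.
rewrite acompA -h2 -acompA.
rewrite -(@atens_compl _ _ X (X ⊗ X^∨ ⊗ X) X); try by ty.
rewrite ev_db_zigzag aid_tens acomp_aidr //; by ety.
Qed.

(** Strictness makes the mate of [db_tens] an identity, and [db_unique] turns this into an equality
    of cups. *)
Lemma db_tensE (V W : C) : adb (V ⊗ W) = (aid V ⊠ adb W ⊠ aid V^∨) • adb V.
Proof.
have e1 : arr (@db_tens _ C V W) = (aid V ⊠ adb W ⊠ aid V^∨) • adb V.
  rewrite /db_tens -!acompE -!atensE -!acompE !coherenceE -/(aid _) -/(adb _) -atensE.
  rewrite -/(aid _) -/(adb _) !(acomp_aidl, acomp_aidr) //; by ety.
rewrite -e1; symmetry; apply: (@db_unique _ (W^∨ ⊗ V^∨)); last 1 first.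
- rewrite -arr_mate; have [_] := is_identityP (st V W).
  by move=> h; rewrite -[X in aid X]odual_tens -h.
- by rewrite e1; ty.
- by rewrite odual_tens.
Qed.

Lemma ev_tensE (V W : C) : aev (V ⊗ W) = aev W • (aid W^∨ ⊠ aev V ⊠ aid W).
Proof.
symmetry; apply: (@ev_unique _ (W^∨ ⊗ V^∨)); rewrite ?strict_objE //; first by ty.
rewrite db_tensE -?aid_tens ?strict_tensE; spread.
exch h (typed_aev V) (typed_adb W).
whisk h' (aid W^∨) (aid V^∨) h; rw h'.
whisk h2 (aid W^∨) aI (ev_db_zigzag_dual V); rw h2; noid.
whisk h3 aI (aid V^∨) (ev_db_zigzag_dual W); rw h3; noid.
by [].
Qed.

(** The pivot is an identity by strictness; unfolded, this is the zigzag condition of [ev_unique]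
    for the right side. *)
Lemma ev_dualE (V : C) : aev V^∨ = aev V • abr V V^∨ • (atw V ⊠ aid V^∨).
Proof.
symmetry; apply: (@ev_unique _ V); rewrite ?strict_objE //; first by ty.
have [_] := is_identityP (sp V).
rewrite /pivot /drinfeld_iso -!acompE -!atensE -!acompE !coherenceE -/(aid _) -/(adb _).
rewrite -/(aev _) -/(abr _ _) -/(atw _) -!/(aid _) !odual_dual; spread; noid.
exch h (typed_atw V) (typed_adb V^∨); rewrite !odual_dual in h.
by rw h.
Qed.

(** The counterpart of [dualm] for arrows; [V] and [W] are arguments because the type [arrow] hides
    endpoints. *)
Definition adual (V W : C) (x : arrow C) : arrow C :=
  (aev W ⊠ aid V^∨) • (aid W^∨ ⊠ ((x ⊠ aid V^∨) • adb V)).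

Lemma ev_adual (V W : C) (x : arrow C) : typed x V W ->
  aev V • (adual V W x ⊠ aid V) = aev W • (aid W^∨ ⊠ x).
Proof.
move=> tx; rewrite /adual; spread.
exch h (typed_aev W) (typed_aev V); rewrite -h.
exch h2 tx (typed_aev V); whisk h3 (aid W^∨) aI (esym h2); rw h3.
whisk h4 (aid W^∨) aI (ev_db_zigzag V); rw h4; noid.
by [].
Qed.

Lemma db_adual (V W : C) (x : arrow C) : typed x V W ->
  (x ⊠ aid V^∨) • adb V = (aid W ⊠ adual V W x) • adb W.
Proof.
move=> tx; rewrite /adual; spread.
exch h (typed_adb W) (typed_adb V); rw (esym h).
exch h2 (typed_adb W) (typed_tens tx (typed_aid V^∨)); rw (esym h2).
whisk h3 aI (aid V^∨) (ev_db_zigzag W); rw h3; noid.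
by [].
Qed.

Lemma typed_adual (V W : C) (x : arrow C) : typed x V W ->
  typed (adual V W x) W^∨ V^∨.
Proof. by move=> tx; rewrite /adual; ty. Qed.

(** * Braiding: hexagons, naturality, sliding past cups and caps *)

Lemma abrK (V W : C) : abri V W • abr V W = aid (V ⊗ W).
Proof.
by have [h _] := invP (braid_iso V W); rewrite acompE h.
Qed.

Lemma abr_nat (V V' W W' : C) (x y : arrow C) : typed x V V' -> typed y W W' ->
  abr V' W' • (x ⊠ y) = (y ⊠ x) • abr V W.
Proof.
by move=> [f ->] [g ->]; rewrite !atensE !acompE braid_nat.
Qed.

Lemma abr_tensr (U V W : C) :
  abr U (V ⊗ W) = (aid V ⊠ abr U W) • (abr U V ⊠ aid W).
Proof.
have := congr1 (@arr _ _ _ _) (hexagonr U V W).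
rewrite -!acompE -!atensE !coherenceE -!/(aid _) -!/(abr _ _).
by rewrite !(acomp_aidl, acomp_aidr) //; ety.
Qed.

Lemma abr_tensl (U V W : C) :
  abr (U ⊗ V) W = (abr U W ⊠ aid V) • (aid U ⊠ abr V W).
Proof.
have := congr1 (@arr _ _ _ _) (hexagonl U V W).
rewrite -!acompE -!atensE !coherenceE -!/(aid _) -!/(abr _ _).
by rewrite !(acomp_aidl, acomp_aidr) //; ety.
Qed.

(** A hexagon makes [abr tunit V] idempotent, and an invertible idempotent is an identity. *)
Lemma abr1l (V : C) : abr tunit V = aid V.
Proof.
have := abr_tensl tunit tunit V; rewrite !strict_tensE ?strict_objE => e.
have := congr1 (acomp (abri tunit V)) e; rewrite acompA abrK !strict_objE acomp_aidl => [<- //|].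
by ety.
Qed.

Lemma abr1r (V : C) : abr V tunit = aid V.
Proof.
have := abr_tensr V tunit tunit; rewrite !strict_tensE ?strict_objE => e.
have := congr1 (acomp (abri V tunit)) e; rewrite acompA abrK !strict_objE acomp_aidl => [<- //|].
by ety.
Qed.

(** Naturality of the braiding along the cup, with a hexagon splitting the crossing of [V] with
    [W ⊗ W^∨]; the next two slides are similar. *)
Lemma slide_db_under (V W : C) :
  (aid W ⊠ abr V W^∨) • (abr V W ⊠ aid W^∨) • (aid V ⊠ adb W) = adb W ⊠ aid V.
Proof.
by rewrite -abr_tensr (abr_nat (typed_aid V) (typed_adb W)) abr1r acomp_aidr //; ety.
Qed.

Lemma slide_db_over (V W : C) :
  (abr W V ⊠ aid W^∨) • (aid W ⊠ abr W^∨ V) • (adb W ⊠ aid V) = aid V ⊠ adb W.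
Proof.
by rewrite -abr_tensl (abr_nat (typed_adb W) (typed_aid V)) abr1l acomp_aidr //; ety.
Qed.

Lemma slide_ev (V W : C) :
  (aev W ⊠ aid V) • (aid W^∨ ⊠ abr V W) • (abr V W^∨ ⊠ aid W) = aid V ⊠ aev W.
Proof.
rewrite -acompA -abr_tensr -(abr_nat (typed_aid V) (typed_aev W)) abr1r acomp_aidl //; ety.
Qed.

(** * Twist and double braiding *)

Lemma atw_nat (V W : C) (x : arrow C) : typed x V W -> atw W • x = x • atw V.
Proof. by move=> [f ->]; rewrite !acompE twist_nat. Qed.

Definition adbr (V W : C) : arrow C := abr W V • abr V W.

Lemma typed_adbr (V W : C) : typed (adbr V W) (V ⊗ W) (V ⊗ W).
Proof. by rewrite /adbr; ty. Qed.

Lemma atw_tens (V W : C) : atw (V ⊗ W) = (atw V ⊠ atw W) • adbr V W.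
Proof.
by rewrite /atw twist_tens /adbr /abr acompE atensE acompE.
Qed.

Lemma adbr_nat (V V' W W' : C) (x y : arrow C) : typed x V V' -> typed y W W' ->
  adbr V' W' • (x ⊠ y) = (x ⊠ y) • adbr V W.
Proof.
move=> tx ty; rewrite /adbr -acompA (abr_nat tx ty) acompA (abr_nat ty tx).
by rewrite acompA.
Qed.

Lemma atw1 : atw tunit = aid tunit.
Proof.
have [t [h _]] := twist_iso (tunit : C).
have hA : arr t • atw tunit = aid tunit by rewrite acompE h.
have tt : typed (arr t) tunit tunit by exact: typed_arr.
have := atw_tens tunit tunit; rewrite /adbr abr1l !strict_objE acomp_aidl; last by ety.
rewrite acomp_aidr; last by ety.
rewrite (atens_exchl (typed_atw _) (typed_atw _)) !strict_tensE => e.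
by have := congr1 (acomp (arr t)) e; rewrite acompA hA acomp_aidl // ; ety.
Qed.

Lemma atw_dual (V : C) : atw V^∨ = adual V V (atw V).
Proof. by rewrite /atw twist_dual /dualm arr_mate -acompE -atensE. Qed.

Lemma ev_tw (V : C) : aev V • (atw V^∨ ⊠ aid V) = aev V • (aid V^∨ ⊠ atw V).
Proof. by rewrite atw_dual ev_adual //; apply: typed_atw. Qed.

(* Naturality of θ along ev_V, with θ_I = id. *)
Lemma ev_dbr (V : C) :
  aev V • adbr V^∨ V • (aid V^∨ ⊠ (atw V • atw V)) = aev V.
Proof.
rewrite -acompA (adbr_nat (typed_aid _) (typed_comp (typed_atw V) (typed_atw V))).
rewrite -{2}[aev V](@acomp_aidl tunit) -?atw1; last by ety.
rewrite (atw_nat (typed_aev V)) atw_tens.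
rewrite (atens_exchl (typed_atw _) (typed_atw _)) !acompA ev_tw.
by spread.
Qed.

(** The zigzag of [V^∨] with the twists of [ev_dualE] and [db_dualE] stripped from its cap and
    cup. *)
Definition kink (V : C) : arrow C :=
  (aev V ⊠ aid V) • (abr V V^∨ ⊠ aid V) • (aid V ⊠ abr V V^∨) • (aid V ⊠ adb V).

Lemma yang_baxter_mixed (V : C) :
  (abr V V^∨ ⊠ aid V) • (aid V ⊠ abr V V^∨) • (abr V V ⊠ aid V^∨) =
  (aid V^∨ ⊠ abr V V) • (abr V V^∨ ⊠ aid V) • (aid V ⊠ abr V V^∨).
Proof.
have := abr_nat (typed_abr V V) (typed_aid V^∨).
by rewrite !abr_tensl !acompA.
Qed.

(* The two V strands pass over V^∨ together, so sliding a crossing c_{V,V}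
   through them straightens the curl into a double braiding under ev_V. *)
Lemma kinkE (V : C) :
  kink V = (aid V ⊠ aev V) • (aid V ⊠ adbr V^∨ V) • (adb V ⊠ aid V).
Proof.
rewrite /kink -(slide_db_over V V) !acompA.
rw (yang_baxter_mixed V).
rewrite -(slide_ev V V) /adbr; spread.
by [].
Qed.

(** By [kinkE] the curl is a double braiding under [aev V], which [ev_dbr] cancels against the two
    twists. *)
Lemma kink_twist (V : C) : kink V • (atw V • atw V) = aid V.
Proof.
rewrite kinkE.
exch h (typed_adb V) (typed_comp (typed_atw V) (typed_atw V)).
rewrite ?acompA; rw h.
have e := ev_dbr V; rewrite /adbr in e.
whisk h2 (aid V) aI e; rewrite h2 ev_db_zigzag.
by [].
Qed.

Lemma typed_kink (V : C) : typed (kink V) V V.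
Proof. by rewrite /kink; ty. Qed.

(** By [db_unique] it suffices to check the zigzag; sliding the twists outwards leaves [kink V]
    between two twists. *)
Lemma db_dualE (V : C) :
  adb V^∨ = (aid V^∨ ⊠ atw V) • abr V V^∨ • adb V.
Proof.
symmetry; apply: (@db_unique _ V); rewrite ?strict_objE //; first by ty.
rewrite ev_dualE; spread.
exch h1 (typed_atw V) (typed_tens (typed_aid V^∨) (typed_atw V)); rw h1.
exch h2 (typed_atw V) (typed_abr V V^∨); rw h2.
exch h3 (typed_atw V) (typed_adb V); rw h3.
exch h4 (typed_abr V V^∨) (typed_atw V); rw h4.
exch h5 (typed_aev V) (typed_atw V); rw h5.
have := kink_twist V; rewrite acompA -(atw_nat (typed_kink V)) /kink !acompA.
by [].
Qed.

(** After [db_dualE] the crossing is pulled by naturality through [x] and through the cap, where it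
    becomes [abr V U]; a zigzag on [V] remains and disappears. *)
Lemma rotationE (V U : C) (x : arrow C) : typed x tunit (V ⊗ U) ->
  (aev V ⊠ aid U ⊠ aid V) • (aid V^∨ ⊠ x ⊠ aid V) • adb V^∨ =
  (aid U ⊠ atw V) • abr V U • x.
Proof.
move=> tx; rewrite db_dualE !acompA.
exch h1 (typed_tens (typed_aid V^∨) tx) (typed_atw V); rw h1.
exch h2 (typed_aev V) (typed_tens (typed_aid U) (typed_atw V)); rw h2.
have := abr_nat (typed_aid V) (typed_tens (typed_aid V^∨) tx).
rewrite ?strict_objE; spread => h3; rw (esym h3).
have := abr_nat (typed_aid V) (typed_tens (typed_aev V) (typed_aid U)).
rewrite ?strict_objE; spread => h4; rw (esym h4).
exch h5 (typed_adb V) tx; rw (esym h5).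
whisk h6 aI (aid U) (ev_db_zigzag V); rw h6; noid.
by [].
Qed.

(** Hexagons split the loop of [X] around [V ⊗ U]; naturality of the braiding along [adbr X U] moves
    the part around [U] past the crossing of [V] and [U]. *)
Lemma adbr_shift (X V U : C) :
  (aid X ⊠ abr V U) • adbr X (V ⊗ U) =
  (adbr X U ⊠ aid V) • (aid X ⊠ abr V U) • (adbr X V ⊠ aid U).
Proof.
have := abr_nat (typed_aid V) (typed_adbr X U).
rewrite {2 3}/adbr abr_tensl !abr_tensr.
rewrite /adbr; spread => h; rw h.
by [].
Qed.

(* Since V^∨^∨ = V and the pivot is the identity, [aev V^∨] is a morphism
   V ⊗ V^∨ -> I and [atr], [apt] are the right pivotal trace and partial trace. *)
Definition atr (A : C) (x : arrow C) : arrow C :=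
  aev A^∨ • (x ⊠ aid A^∨) • adb A.

Definition apt (A V : C) (x : arrow C) : arrow C :=
  (aid A ⊠ aev V^∨) • (x ⊠ aid V^∨) • (aid A ⊠ adb V).

Lemma typed_apt (A V : C) (x : arrow C) : typed x (A ⊗ V) (A ⊗ V) ->
  typed (apt A V x) A A.
Proof. by move=> tx; rewrite /apt; ty. Qed.

Lemma atr_tens (A V : C) (x : arrow C) : typed x (A ⊗ V) (A ⊗ V) ->
  atr (A ⊗ V) x = atr A (apt A V x).
Proof.
move=> tx; rewrite /atr /apt db_tensE odual_tens ev_tensE; spread.
by rewrite odual_dual.
Qed.

Lemma apt_tens (A V W : C) (x : arrow C) :
  typed x (A ⊗ V ⊗ W) (A ⊗ V ⊗ W) ->
  apt A (V ⊗ W) x = apt A V (apt (A ⊗ V) W x).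
Proof.
move=> tx; rewrite /apt db_tensE odual_tens ev_tensE; spread.
by rewrite odual_dual.
Qed.

(** Neither [h1] nor [h2] touches the closed strand [V], so interchange pulls both out of the
    loop. *)
Lemma apt_whisker (P A R V : C) (h1 x h2 : arrow C) :
  typed h1 (P ⊗ A) R -> typed x (A ⊗ V) (A ⊗ V) -> typed h2 R (P ⊗ A) ->
  apt R V ((h1 ⊠ aid V) • (aid P ⊠ x) • (h2 ⊠ aid V)) =
  h1 • (aid P ⊠ apt A V x) • h2.
Proof.
move=> t1 tx t2; rewrite /apt; spread.
exch e1 t1 (typed_aev V^∨); rewrite !odual_dual in e1; rw (esym e1).
exch e2 t2 (typed_adb V); rw e2.
by [].
Qed.

(** A framed first Reidemeister move: [ev_dualE] contributes the twist, and the rest of the curl is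
    undone by [slide_db_under] and a zigzag. *)
Lemma apt_braid (V : C) : apt V V (abr V V) = atw V.
Proof.
rewrite /apt ev_dualE; spread.
have := abr_nat (typed_atw V) (typed_aid V); rewrite ?strict_objE => h.
whisk h2 aI (aid V^∨) (esym h); rw h2.
exch h3 (typed_atw V) (typed_adb V); rw h3.
rw (slide_db_under V V); rw (ev_db_zigzag V); noid.
by [].
Qed.

Lemma ev_dual_adual (V W : C) (x : arrow C) : typed x V W ->
  aev V^∨ • (aid V ⊠ adual V W x) = aev W^∨ • (x ⊠ aid W^∨).
Proof.
move=> tx; move: (adual V W x) (typed_adual tx) (ev_adual tx) => x' tx' e.
rewrite !ev_dualE; exch h1 (typed_atw V) tx'; rw h1.
rw (abr_nat (typed_aid V) tx'); rw e.
rw (esym (abr_nat tx (typed_aid W^∨))).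
whisk h2 aI (aid W^∨) (atw_nat tx); rw h2.
by [].
Qed.

(** [y] travels around the closure as its transpose: over the cup by [db_adual], back over the cap
    by [ev_dual_adual]. *)
Lemma atr_cyclic (A B : C) (x y : arrow C) : typed x B A -> typed y A B ->
  atr A (x • y) = atr B (y • x).
Proof.
move=> tx ty; rewrite /atr; spread.
move: (adual A B y) (typed_adual ty) (db_adual ty) (ev_dual_adual ty) => y' ty' e e'.
rw e; exch h tx ty'; rw h; rw e'.
by [].
Qed.

(** Expanded by [ev_dualE] and [db_dualE], the two loops differ only in the side of the crossing
    that carries the twist. *)
Lemma atr_dual (V : C) : atr V^∨ (aid V^∨) = atr V (aid V).
Proof.
rewrite /atr !aid_tens !acomp_aidr; try by ety.
rewrite odual_dual ev_dualE db_dualE !acompA.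
by rw (abr_nat (typed_atw V) (typed_aid V^∨)).
Qed.

Lemma apt_aid (A V : C) : apt A V (aid (A ⊗ V)) = aid A ⊠ atr V (aid V).
Proof.
rewrite /apt /atr; spread; noid.
by [].
Qed.

(** Nested loops: [Z] is closed first, inside the crossings of [K] with [Y]. This yields
    multiplicativity in [chi_tens]. *)
Lemma apt_adbr_tens (K Y Z : C) :
  apt K (Y ⊗ Z) (adbr K (Y ⊗ Z)) =
  apt K Y (abr Y K • (aid Y ⊠ apt K Z (adbr K Z)) • abr K Y).
Proof.
rewrite apt_tens; last exact: typed_adbr.
rewrite -(@apt_whisker Y K (K ⊗ Y) Z (abr Y K) (adbr K Z) (abr K Y));
  [|by ty|exact: typed_adbr|by ty].
rewrite {1 2}/adbr abr_tensl abr_tensr; spread.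
by [].
Qed.

(** * The closed rotation braid *)

Lemma tpow_comm (V : C) m : tpow V m ⊗ V = V ⊗ tpow V m.
Proof. by elim: m => [|m IH] /=; rewrite ?strict_objE // IH. Qed.

Definition arot (X V : C) : arrow C := (aid X ⊠ atw V) • adbr X V.

Lemma typed_arot (X V : C) : typed (arot X V) (X ⊗ V) (X ⊗ V).
Proof. by rewrite /arot; apply: typed_comp (typed_adbr _ _); ty. Qed.

Definition aiter (x : arrow C) n (y : arrow C) := iter n (acomp x) y.

(* Writing V^{⊗m} as U ⊗ V, [adbr_shift] exhibits the last strand as a curl
   c_{V,V}, which the partial trace replaces by θ_V. *)
Lemma atr_rotation (X V : C) m (g : arrow C) : typed g (X ⊗ V) (X ⊗ V) ->
  atr (X ⊗ V ⊗ tpow V m)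
    ((aid X ⊠ abr V (tpow V m)) • adbr X (V ⊗ tpow V m) • (g ⊠ aid (tpow V m))) =
  atr (X ⊗ V) (adbr X V • aiter (arot X V) m g).
Proof.
elim: m g => [|m IH] g tg.
  by rewrite /= !strict_objE abr1r !aid_tens strict_tensE acomp_aidl //; eexists; apply: typed_adbr.
(* A removed strand leaves one factor [arot X V] in front of [g], so the induction is over all
   [g]. *)
rewrite /aiter iterSr -/(aiter _ _ _) [tpow _ _]/= -IH; last exact: typed_comp (typed_arot _ _) tg.
rewrite adbr_shift -{1 2 3 4 5}tpow_comm.
move: (tpow V m) (tpow_comm V m) => U e {IH}.
have tD := typed_adbr X V; have tD1 := typed_adbr X (U ⊗ V).
have := adbr_nat (typed_aid X) (typed_abr V U).
rewrite /arot; move: (adbr X V) (adbr X (U ⊗ V)) (adbr X (V ⊗ U)) tD tD1.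
move=> d d1 d2 td td1 hd.
have -> : (d1 ⊠ aid V) • (aid X ⊠ abr V (U ⊗ V)) • (d ⊠ aid (U ⊗ V)) •
    (g ⊠ aid (U ⊗ V)) =
    (d1 ⊠ aid V) • (aid (X ⊗ U) ⊠ abr V V) •
    (((aid X ⊠ abr V U) • (d ⊠ aid U) • (g ⊠ aid U)) ⊠ aid V).
  by rewrite abr_tensr; spread.
have -> : X ⊗ V ⊗ U ⊗ V = (X ⊗ V ⊗ U) ⊗ V by rewrite !strict_objE.
have t1 : typed d1 ((X ⊗ U) ⊗ V) (X ⊗ V ⊗ U).
  by apply: typed_cast td1 _ _; rewrite ?strict_objE // e.
have t2 : typed ((aid X ⊠ abr V U) • (d ⊠ aid U) • (g ⊠ aid U)) (X ⊗ V ⊗ U)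
    ((X ⊗ U) ⊗ V) by ty.
rewrite atr_tens; last by ty.
rewrite (apt_whisker t1 (typed_abr V V) t2) apt_braid; congr atr.
have := congr1 (fun x => aid X ⊠ x) (abr_nat (typed_atw V) (typed_aid U)).
rewrite /=; spread => h; rw (esym h); rw hd.
by [].
Qed.

(** [adbr X V] commutes with [arot X V], hence can be moved inwards to complete the initial twist to
    one more [arot X V]. *)
Lemma adbr_aiter (X V : C) m :
  adbr X V • aiter (arot X V) m (aid X ⊠ atw V) = aiter (arot X V) m (arot X V).
Proof.
elim: m => [|m IH]; first by rewrite /= (adbr_nat (typed_aid X) (typed_atw V)).
have e : adbr X V • arot X V = arot X V • adbr X V.
  by rewrite /arot acompA (adbr_nat (typed_aid X) (typed_atw V)).
by rewrite /aiter !iterS -!/(aiter _ _ _) -IH [LHS]acompA e -acompA.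
Qed.

Lemma arr_tpow_shift (V : C) m : arr (tpow_shift V m) = aid (V ⊗ tpow V m).
Proof.
elim: m => [|m IH]; first by rewrite /= -acompE !coherenceE acomp_aidl ?strict_objE //; ety.
rewrite -acompE -atensE IH !coherenceE -/(aid _) !aid_tens -/(tpow V m) tpow_comm.
by rewrite acomp_aidl //; ety.
Qed.

Lemma arr_minv_pivot (V : C) : arr (minv (pivot V)) = aid V.
Proof. by rewrite is_identity_minv // odual_dual. Qed.

Definition arots (V : C) m : arrow C := abr V (tpow V m) • (atw V ⊠ aid (tpow V m)).

Lemma arr_FS_operator (V : C) m (f : mor tunit (tpow V m.+1)) :
  arr (FS_operator f) = arots V m • arr f.
Proof.
rewrite /FS_operator -!acompE -!atensE -!acompE -!atensE.
rewrite arr_tpow_shift arr_minv_pivot !coherenceE -!/(aid _) -/(aev _) -/(adb _).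
have tf : typed (arr f) tunit (V ⊗ tpow V m) by exists f.
move: (arr f) tf => x tx; rewrite -{1}tpow_comm !aid_tens acomp_aidl; last first.
  by eexists; ty.
rewrite acomp_aidl; last by ety.
rewrite !acomp_aidr; try by ety.
rewrite !strict_tensE (rotationE tx) /arots.
by rewrite (abr_nat (typed_atw V) (typed_aid _)).
Qed.

Lemma atr_arots (X V : C) m :
  atr (X ⊗ V ⊗ tpow V m) ((aid X ⊠ arots V m) • adbr X (V ⊗ tpow V m)) =
  atr (X ⊗ V) (aiter (arot X V) m (arot X V)).
Proof.
rewrite -adbr_aiter -atr_rotation; last by ty.
have := adbr_nat (typed_aid X) (typed_tens (typed_atw V) (typed_aid (tpow V m))).
rewrite /arots; move: (adbr X _) => d; spread => h; rw h.
by [].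
Qed.

Lemma atr1 : atr tunit (aid tunit) = aid tunit.
Proof.
rewrite /atr ev_dualE atw1 abr1l !aid_tens !acomp_aidr; try by ety.
by have := ev_db_zigzag tunit; rewrite !strict_tensE.
Qed.

Lemma adbr1 (V : C) : adbr tunit V = aid V.
Proof. by rewrite /adbr abr1l abr1r acomp_aidl //; ety. Qed.

Lemma atrZ (A : C) (a : F) (x : arrow C) : atr A (ascale a x) = ascale a (atr A x).
Proof. by rewrite /atr atensZl acompZr acompZl. Qed.

Lemma aptZ (A V : C) (a : F) (x : arrow C) :
  apt A V (ascale a x) = ascale a (apt A V x).
Proof. by rewrite /apt atensZl acompZr acompZl. Qed.

(* Frobenius reciprocity C(A ⊗ V, B) = C(A, B ⊗ V^∨). *)
Definition bend (A V B : C) (f : mor (A ⊗ V) B) : mor A (B ⊗ V^∨) :=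
  (f ⊗m idm V^∨) ∘ minv (assoc A V V^∨) ∘ (idm A ⊗m db V) ∘ minv (runit A).

Definition unbend (A V B : C) (g : mor A (B ⊗ V^∨)) : mor (A ⊗ V) B :=
  runit B ∘ (idm B ⊗m ev V) ∘ assoc B V^∨ V ∘ (g ⊗m idm V).

Lemma arr_bend (A V B : C) (f : mor (A ⊗ V) B) :
  arr (bend f) = (arr f ⊠ aid V^∨) • (aid A ⊠ adb V).
Proof.
rewrite /bend -!acompE -!atensE !coherenceE -!/(aid _) -/(adb _).
by rewrite !acomp_aidr //; ety.
Qed.

Lemma arr_unbend (A V B : C) (g : mor A (B ⊗ V^∨)) :
  arr (unbend g) = (aid B ⊠ aev V) • (arr g ⊠ aid V).
Proof.
rewrite /unbend -!acompE -!atensE !coherenceE -!/(aid _) -/(aev _).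
rewrite acomp_aidl; last by ety.
by rewrite acomp_aidr //; ety.
Qed.

Lemma bendK (A V B : C) : cancel (@bend A V B) (@unbend A V B).
Proof.
move=> f; apply: arr_inj; rewrite arr_unbend arr_bend.
move: (arr f) (typed_arr f) => x tx; spread.
exch h tx (typed_aev V); rw (esym h).
whisk h2 (aid A) aI (ev_db_zigzag V); rw h2; noid.
by [].
Qed.

Lemma unbendK (A V B : C) : cancel (@unbend A V B) (@bend A V B).
Proof.
move=> g; apply: arr_inj; rewrite arr_bend arr_unbend.
move: (arr g) (typed_arr g) => x tx; spread.
exch h tx (typed_adb V); rw h.
whisk h2 (aid B) aI (ev_db_zigzag_dual V); rw h2; noid.
by [].
Qed.

Lemma bend_linear (A V B : C) : linear (@bend A V B).
Proof. by move=> a f g; rewrite /bend tensm_linearl !comp_linearl. Qed.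

Lemma unbend_linear (A V B : C) : linear (@unbend A V B).
Proof. by move=> a f g; rewrite /unbend tensm_linearl comp_linearr. Qed.

Lemma arr_dualm (V W : C) (f : mor V W) : arr (dualm f) = adual V W (arr f).
Proof. by rewrite /dualm arr_mate -acompE -atensE. Qed.

Lemma dualm_linear (V W : C) : linear (@dualm F C V W).
Proof.
move=> a f g; rewrite /dualm /mate tensm_linearl comp_linearl tensm_linearr.
by rewrite comp_linearr comp_linearl.
Qed.

(** By [rec] an arrow is recovered from [aev W • (aid W^∨ ⊠ x)], which by [ev_adual] depends only on
    its transpose. *)
Lemma dualm_inj (V W : C) : injective (@dualm F C V W).
Proof.
have rec (x : arrow C) : typed x V W ->
    x = (aid W ⊠ (aev W • (aid W^∨ ⊠ x))) • (adb W ⊠ aid V).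
  move=> tx; spread; exch h (typed_adb W) tx; rw (esym h).
  by rw (ev_db_zigzag W); noid.
move=> f g e; apply: arr_inj; rewrite (rec _ (typed_arr f)) (rec _ (typed_arr g)).
rewrite -(ev_adual (typed_arr f)) -(ev_adual (typed_arr g)).
by rewrite -!arr_dualm e.
Qed.

Lemma dualm_id (V : C) : dualm (idm V) = idm V^∨.
Proof.
apply: arr_inj; rewrite arr_dualm /adual -!/(aid _) aid_tens acomp_aidl; last by ety.
exact: ev_db_zigzag_dual.
Qed.

End StrictRibbon.

(** * Traces and dimensions of hom spaces *)

Section LinearAlgebra.
Variable F : fieldType.

Lemma dim_le_injective (U V : vectType F) (f : U -> V) :
  linear f -> injective f -> (\dim {:U} <= \dim {:V})%N.
Proof.
move=> fl fi.
pose g : {linear U -> V} := HB.pack f (GRing.isLinear.Build _ _ _ _ f fl).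
have kg : lker (linfun g) == 0%VS.
  by apply/lker0P => x y; rewrite !lfunE => /fi.
by rewrite -(limg_dim_eq (f := linfun g)) ?dimvS ?subvf // (eqP kg) capv0.
Qed.

(* Computes a trace from any dual pair of families [u], [φ] resolving the
   identity, which need not consist of linearly independent vectors. *)
Lemma lin_trace_frame (U : vectType F) (E : {linear U -> U}) (I : finType)
    (P : pred I) (u : I -> U) (φ : I -> U -> F) :
  (forall a, linear (φ a : U -> F^o)) ->
  (forall x, x = \sum_(a | P a) φ a x *: u a) ->
  lin_trace E = \sum_(a | P a) φ a (E (u a)).
Proof.
move=> φl fr; rewrite /lin_trace.
set v := vbasis _.
transitivity (\sum_(i < \dim {:U}) \sum_(a | P a) φ a (E v`_i) * coord v i (u a)).
  by apply: eq_bigr => i _; rewrite {1}(fr (E v`_i)) linear_sum;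
    apply: eq_bigr => a _; rewrite linearZ.
rewrite exchange_big; apply: eq_bigr => a _ /=.
rewrite {2}(coord_vbasis (memvf (u a))) linear_sum.
rewrite (linear_bigsum _ _ _ (φl a)); apply: eq_bigr => i _.
by rewrite linearZ (linear_scale _ _ (φl a)) mulrC.
Qed.

(** Together with [lin_trace_frame] this counts dimensions of hom spaces, as elements of [F]. *)
Lemma lin_trace_id (U : vectType F) (E : {linear U -> U}) :
  (forall x, E x = x) -> lin_trace E = (\dim {:U})%:R.
Proof.
move=> e; rewrite /lin_trace -[in RHS](card_ord (\dim {:U})) -sum1_card natr_sum.
apply: eq_bigr => i _; rewrite e coord_free ?eqxx //.
by apply: basis_free; apply: vbasisP.
Qed.

End LinearAlgebra.

Lemma scale_vec_inj (F : fieldType) (U : lmodType F) (u : U) (a b : F) :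
  u != 0 -> a *: u = b *: u -> a = b.
Proof.
move=> u0 /eqP; rewrite -subr_eq0 -scalerBl scaler_eq0 (negbTE u0) orbF.
by rewrite subr_eq0 => /eqP.
Qed.

(** * Schur's lemma and scalar endomorphisms *)

Section Schur.
Variables (F : fieldType) (C : linear_category F).

Lemma comp_sumr (A B D : C) (I : Type) (r : seq I) (P : pred I)
    (f : I -> mor A B) (g : mor B D) :
  g ∘ (\sum_(i <- r | P i) f i) = \sum_(i <- r | P i) g ∘ f i.
Proof. exact: (linear_bigsum _ _ _ (@comp_linearr _ _ _ _ _ g)). Qed.

Lemma comp_suml (A B D : C) (I : Type) (r : seq I) (P : pred I)
    (f : mor A B) (g : I -> mor B D) :
  (\sum_(i <- r | P i) g i) ∘ f = \sum_(i <- r | P i) g i ∘ f.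
Proof. exact: (linear_bigsum _ _ _ (@comp_linearl _ _ _ _ _ f)). Qed.

Lemma comp0l (A B D : C) (f : mor A B) : (0 : mor B D) ∘ f = 0.
Proof. exact: (linear_zero (@comp_linearl _ _ _ _ _ f)). Qed.

Lemma comp0r (A B D : C) (g : mor B D) : g ∘ (0 : mor A B) = 0.
Proof. exact: (linear_zero (@comp_linearr _ _ _ _ _ g)). Qed.

Lemma compBr (A B D : C) (g : mor B D) (f f' : mor A B) :
  g ∘ (f - f') = g ∘ f - g ∘ f'.
Proof.
rewrite (linear_add _ _ (@comp_linearr _ _ _ _ _ g)) -[- f']scaleN1r.
by rewrite compZr scaleN1r.
Qed.

Lemma idm0_zero (A : C) : idm A = 0 -> is_zero A.
Proof.
move=> e B; split=> f.
  by rewrite -[f]comp1m e comp0l.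
by rewrite -[f]compm1 e comp0r.
Qed.

Lemma simple_idm_neq0 (A : C) : simple A -> idm A != 0.
Proof. by move=> [nz _]; apply/eqP => /idm0_zero. Qed.

(** Simplicity of [A], applied to the kernel of [f], forces that kernel to be zero, so [f] is mono;
    simplicity of [B] then applies to [f] itself. *)
Lemma schur (A B : C) (f : mor A B) : abelian_category C ->
  simple A -> simple B -> f <> 0 -> is_iso f.
Proof.
move=> [_ kers _ _ _] [nzA sA] [nzB sB] f0.
have [K [k [fk ku]]] := kers _ _ f.
have mk : mono k.
  move=> T s t e.
  have [w [_ wu]] := ku T (k ∘ s) ltac:(by rewrite Defs.compA fk comp0l).
  by rewrite -(wu s erefl) -(wu t (esym e)).
case: (sA _ _ mk) => [zK|[g [_ kg]]]; last first.
  by case: f0; rewrite -[f]compm1 -kg Defs.compA fk comp0l.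
have mf : mono f.
  move=> T s t e.
  have h : f ∘ (s - t) = 0 by rewrite compBr e subrr.
  have [w [kw _]] := ku T _ h.
  by apply/eqP; rewrite -subr_eq0 -kw (proj1 (zK T) w) comp0r.
by case: (sB _ _ mf) => [/nzA|].
Qed.

(** It represents [f] only when [idm A] spans [mor A A], see [escalarE]. *)
Definition escalar (A : C) (f : mor A A) : F := coord [tuple idm A] ord0 f.

Lemma escalarE (A : C) (f : mor A A) : idm A != 0 -> \dim {: mor A A} = 1%N ->
  f = escalar f *: idm A.
Proof.
move=> id0 d1.
have : f \in <<[tuple idm A]>>%VS.
  rewrite span_seq1; have -> : <[idm A]>%VS = fullv.
    by apply/eqP; rewrite eqEdim subvf d1 dim_vline id0.
  exact: memvf.
by move=> /coord_span {1}->; rewrite big_ord1.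
Qed.

Lemma escalar_linear (A : C) : linear (@escalar A : mor A A -> F^o).
Proof. by move=> a x y; rewrite /escalar linearP. Qed.

Lemma escalarZ (A : C) (a : F) : simple A -> \dim {: mor A A} = 1%N ->
  escalar (a *: idm A) = a.
Proof.
move=> sA d1; have := escalarE (a *: idm A) (simple_idm_neq0 sA) d1.
by move/(scale_vec_inj (simple_idm_neq0 sA)).
Qed.

End Schur.

Section HomDimensions.
Variables (F : fieldType) (C : linear_category F).

Lemma dim_hom_retractr (A Y Y' : C) (f : mor Y Y') (g : mor Y' Y) :
  g ∘ f = idm Y -> (\dim {: mor A Y} <= \dim {: mor A Y'})%N.
Proof.
move=> gf; apply: (dim_le_injective (@comp_linearr _ _ _ _ _ f)) => x y /= e.
by rewrite -[x]comp1m -[y]comp1m -gf -!Defs.compA e.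
Qed.

Lemma dim_hom_isor (A Y Y' : C) : isomorphic Y Y' ->
  \dim {: mor A Y} = \dim {: mor A Y'}.
Proof.
by move=> [f [g [gf fg]]]; apply/eqP; rewrite eqn_leq (dim_hom_retractr _ gf) (dim_hom_retractr _ fg).
Qed.

Lemma dim_hom_retractl (A Y Y' : C) (f : mor Y Y') (g : mor Y' Y) :
  g ∘ f = idm Y -> (\dim {: mor Y A} <= \dim {: mor Y' A})%N.
Proof.
move=> gf; apply: (dim_le_injective (@comp_linearl _ _ _ _ _ g)) => x y /= e.
by rewrite -[x]compm1 -[y]compm1 -gf !Defs.compA e.
Qed.

Lemma dim_hom_isol (A Y Y' : C) : isomorphic Y Y' ->
  \dim {: mor Y A} = \dim {: mor Y' A}.
Proof.
by move=> [f [g [gf fg]]]; apply/eqP; rewrite eqn_leq (dim_hom_retractl _ gf) (dim_hom_retractl _ fg).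
Qed.

End HomDimensions.

Section Frames.
Variables (F : fieldType) (C : linear_category F) (Γ : finType) (X : Γ -> C).
Hypothesis abelC : abelian_category C.
Hypothesis ssC : semisimple C.
Hypothesis simplesX : complete_simples X.
Hypothesis dim1 : forall Y : C, simple Y -> \dim {: mor Y Y} = 1%N.

Lemma simpleX i : simple (X i).
Proof. by case: simplesX. Qed.

Lemma idX_neq0 i : idm (X i) != 0.
Proof. exact: simple_idm_neq0 (simpleX i). Qed.

Lemma endX i (f : mor (X i) (X i)) : f = escalar f *: idm (X i).
Proof. by apply: escalarE (idX_neq0 i) (dim1 (simpleX i)). Qed.

Lemma escalarX i a : escalar (a *: idm (X i)) = a.
Proof. by apply: escalarZ (simpleX i) (dim1 (simpleX i)). Qed.

Lemma homX_neq i j (f : mor (X i) (X j)) : i != j -> f = 0.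
Proof.
move=> /eqP ij; apply: contrapT => /(schur abelC (simpleX i) (simpleX j)) fi.
by apply: ij; case: simplesX => _ h _; apply: h; exists f.
Qed.

(** The families are total, as restricted sums require; outside [P] nothing is asserted of their
    values. *)
Lemma iso_choice (I : Type) (Y Z : I -> C) (P : I -> Prop) :
  (forall a, P a -> isomorphic (Y a) (Z a)) ->
  exists (s : forall a, mor (Y a) (Z a)) (t : forall a, mor (Z a) (Y a)),
    forall a, P a -> inverse_to (s a) (t a).
Proof.
move=> h; exists (fun a => xget 0 [set f | is_iso f]%classic).
exists (fun a => minv (xget 0 [set f : mor (Y a) (Z a) | is_iso f]%classic)).
move=> a /h [f fi]; apply: invP.
by apply: (@xgetPex _ 0 [set f | is_iso f]%classic); exists f.
Qed.

(** A direct sum decomposition whose summands are members of [X] themselves, kept as explicit data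
    to turn traces into sums over [a]. *)
Definition frame (A : C) n (κ : 'I_n -> Γ) (u : forall a, mor (X (κ a)) A)
    (p : forall a, mor A (X (κ a))) : Prop :=
  [/\ forall a, p a ∘ u a = idm (X (κ a)),
      forall a b, a != b -> p a ∘ u b = 0
    & \sum_a u a ∘ p a = idm A].

Lemma frame_exists (A : C) : exists n (κ : 'I_n -> Γ)
  (u : forall a, mor (X (κ a)) A) (p : forall a, mor A (X (κ a))), frame u p.
Proof.
have [n [Y [sY [u [p [pu1 pu0 up]]]]]] := ssC A.
have /boolp.choice [κ hκ] : forall a, exists i, isomorphic (Y a) (X i).
  by move=> a; case: simplesX => _ _; apply; apply: sY.
have [s [t st]] := @iso_choice 'I_n Y (X \o κ) (fun=> True) (fun a _ => hκ a).
exists n, κ, (fun a => u a ∘ t a), (fun a => s a ∘ p a); split.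
- move=> a; have [_ e] := st a I.
  by rewrite Defs.compA -(Defs.compA (s a)) pu1 compm1.
- move=> a b ab.
  by rewrite Defs.compA -(Defs.compA (s a)) pu0 // comp0r comp0l.
- rewrite -up; apply: eq_bigr => a _; have [e _] := st a I.
  by rewrite Defs.compA -(Defs.compA (u a)) e compm1.
Qed.

Section OneFrame.
Variables (A : C) (n : nat) (κ : 'I_n -> Γ).
Variables (u : forall a, mor (X (κ a)) A) (p : forall a, mor A (X (κ a))).
Hypothesis up : frame u p.

Lemma frame_post (Y : C) (x : mor Y A) : x = \sum_a u a ∘ (p a ∘ x).
Proof.
case: up => _ _ e; rewrite -{1}[x]comp1m -e comp_suml.
by apply: eq_bigr => a _; rewrite Defs.compA.
Qed.

Lemma frame_pre (Y : C) (x : mor A Y) : x = \sum_a (x ∘ u a) ∘ p a.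
Proof.
case: up => _ _ e; rewrite -{1}[x]compm1 -e comp_sumr.
by apply: eq_bigr => a _; rewrite Defs.compA.
Qed.

(** The vectors [u a ∘ s a] with [κ a = k] and the scalars of [p a ∘ x ∘ t a] are dual families; the
    other summands vanish by Schur. Asking only that [Y] be isomorphic to [X k] covers the unit
    object. *)
Lemma lin_trace_post (B : mor A A) (k : Γ) (Y : C)
    (E : {linear mor Y A -> mor Y A}) :
  isomorphic Y (X k) -> (forall f, E f = B ∘ f) ->
  lin_trace E = \sum_(a | κ a == k) escalar (p a ∘ (B ∘ u a)).
Proof.
move=> isoY EB.
have [s [t st]] : exists (s : forall a, mor Y (X (κ a))) (t : forall a, mor (X (κ a)) Y),
    forall a, κ a = k -> inverse_to (s a) (t a).
  by apply: iso_choice => a ->.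
rewrite (@lin_trace_frame _ _ _ _ (fun a => κ a == k) (fun a => u a ∘ s a)
  (fun a x => escalar (p a ∘ x ∘ t a))).
- apply: eq_bigr => a /eqP /st [_ e]; rewrite EB.
  by congr escalar; rewrite -!Defs.compA e compm1.
- move=> a c x y; rewrite comp_linearr comp_linearl; exact: escalar_linear.
- move=> x; rewrite {1}(frame_post x) [LHS](bigID (fun a => κ a == k)) /=.
  rewrite [X in _ + X]big1 ?addr0 => [|a nk].
    apply: eq_bigr => a /eqP /st [e _].
    rewrite -compZr; congr (_ ∘ _).
    by rewrite -[s a]comp1m -compZl -endX -!Defs.compA e compm1.
  suff -> : p a ∘ x = 0 by rewrite comp0r.
  have [f [g [gf fg]]] := isoY.
  rewrite -[p a ∘ x]compm1 -gf Defs.compA [_ ∘ g]homX_neq ?comp0l //.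
  by rewrite eq_sym.
Qed.

Lemma dim_hom_frame (k : Γ) :
  (\dim {: mor (X k) A})%:R = \sum_(a | κ a == k) 1 :> F.
Proof.
rewrite -(@lin_trace_id _ (mor (X k) A) idfun) // (@lin_trace_post (idm A) k) //.
- by apply: eq_bigr => a _; rewrite comp1m; case: up => -> _ _;
    rewrite -[idm _]scale1r escalarX.
- by exists (idm (X k)), (idm (X k)); split; rewrite comp1m.
- by move=> f; rewrite comp1m.
Qed.

Lemma dim_hom_from_frame (k : Γ) :
  (\dim {: mor A (X k)})%:R = \sum_(a | κ a == k) 1 :> F.
Proof.
have [s [t st]] : exists (s : forall a, mor (X (κ a)) (X k)) (t : forall a, mor (X k) (X (κ a))),
    forall a, κ a = k -> inverse_to (s a) (t a).
  by apply: iso_choice => a ->; exists (idm (X k)), (idm (X k)); split; rewrite comp1m.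
rewrite -(@lin_trace_id _ (mor A (X k)) idfun) //.
rewrite (@lin_trace_frame _ _ _ _ (fun a => κ a == k) (fun a => s a ∘ p a)
  (fun a x => escalar (t a ∘ (x ∘ u a)))).
- apply: eq_bigr => a /eqP /st [e _] /=; case: up => pu _ _.
  by rewrite -Defs.compA pu compm1 e -[idm _]scale1r escalarX.
- move=> a c x y; rewrite comp_linearl comp_linearr; exact: escalar_linear.
- move=> x; rewrite {1}(frame_pre x) [LHS](bigID (fun a => κ a == k)) /=.
  rewrite [X in _ + X]big1 ?addr0 => [|a nk]; last by rewrite [x ∘ u a]homX_neq ?comp0l.
  apply: eq_bigr => a /eqP /st [_ e].
  rewrite -compZl; congr (_ ∘ _).
  by rewrite -[s a]compm1 -compZr -endX Defs.compA e comp1m.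
Qed.

Lemma sum_frame (g : Γ -> F) :
  \sum_a g (κ a) = \sum_k (\dim {: mor (X k) A})%:R * g k.
Proof.
rewrite (partition_big κ xpredT) //=; apply: eq_bigr => k _.
rewrite dim_hom_frame mulr_suml; apply: eq_bigr => a /eqP ->.
by rewrite mul1r.
Qed.

End OneFrame.

(** Both sides count the summands of type [k] in one frame of [A]. *)
Lemma dim_hom_sym (A : C) k :
  (\dim {: mor A (X k)})%:R = (\dim {: mor (X k) A})%:R :> F.
Proof.
have [n [κ [u [p up]]]] := frame_exists A.
by rewrite (dim_hom_frame up) (dim_hom_from_frame up).
Qed.

End Frames.

Section HomDuality.
Variables (F : fieldType) (C : ribbon_category F).
Hypothesis sC : strict_category C.

Lemma dim_hom_tens (A V B : C) :
  \dim {: mor (A ⊗ V) B} = \dim {: mor A (B ⊗ V^∨)}.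
Proof.
apply/eqP; rewrite eqn_leq; apply/andP; split.
  apply: (@dim_le_injective _ _ _ (@bend F C A V B)); first exact: bend_linear.
  exact: (can_inj (bendK sC (A:=A) (V:=V) (B:=B))).
apply: (@dim_le_injective _ _ _ (@unbend F C A V B)); first exact: unbend_linear.
exact: (can_inj (unbendK sC (A:=A) (V:=V) (B:=B))).
Qed.

Lemma dim_hom_dual (V W : C) : \dim {: mor W^∨ V^∨} = \dim {: mor V W}.
Proof.
have le (A B : C) : (\dim {: mor A B} <= \dim {: mor B^∨ A^∨})%N.
  apply: (@dim_le_injective _ _ _ (@dualm F C A B)); first exact: dualm_linear.
  exact: dualm_inj.
apply/eqP; rewrite eqn_leq le andbT.
by have := le W^∨ V^∨; rewrite !(odual_dual sC).
Qed.

Lemma braid_isomorphic (A B : C) : isomorphic (A ⊗ B) (B ⊗ A).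
Proof. by exists (braid A B); apply: braid_iso. Qed.

End HomDuality.

(** * Traces in a modular category *)

Section Traces.
Variables (F : fieldType) (C : ribbon_category F).
Hypothesis sC : strict_category C.
Hypothesis fusC : fusion C.

Let abelC : abelian_category C. Proof. by case: fusC. Qed.
Let ssC : semisimple C. Proof. by case: fusC. Qed.
Let simple1 : simple (tunit : C). Proof. by case: fusC. Qed.
Let dim1 (Y : C) : simple Y -> \dim {: mor Y Y} = 1%N.
Proof. by case: fusC => _ _ _ _; apply. Qed.

Lemma tens_sumr (A B A' B' : C) (I : Type) (r : seq I) (P : pred I)
    (f : mor A A') (g : I -> mor B B') :
  f ⊗m (\sum_(i <- r | P i) g i) = \sum_(i <- r | P i) f ⊗m g i.
Proof. exact: (linear_bigsum _ _ _ (@tensm_linearr _ _ _ _ _ _ f)). Qed.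

(** Strictness erases the pivot, and [unit_scalar] is faithful because the endomorphisms of the
    simple unit are scalars. *)
Lemma ptrP (V : C) (f : mor V V) :
  arr (ptr f *: idm (tunit : C)) = atr V (arr f).
Proof.
rewrite /ptr /unit_scalar -/(escalar _) -escalarE; [|exact: simple_idm_neq0|exact: dim1].
rewrite -!acompE -atensE -acompE.
have [_ _ /(_ V)/is_identityP [_ ->] _] := sC.
by rewrite (acomp1l (typed_cast (typed_arr f) erefl erefl)).
Qed.

Lemma ptr_eq (A B : C) (f : mor A A) (g : mor B B) (c : F) :
  atr A (arr f) = ascale c (atr B (arr g)) -> ptr f = c * ptr g.
Proof.
rewrite -!ptrP ascaleE scalerA => /arr_inj.
exact: scale_vec_inj (simple_idm_neq0 simple1).
Qed.

Lemma ascale1 (x : arrow C) : ascale 1 x = x.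
Proof. by case: x => [[[A B] f]|] //; rewrite -!/(arr _) ascaleE scale1r. Qed.

Lemma ascaleA (a b : F) (x : arrow C) : ascale a (ascale b x) = ascale (a * b) x.
Proof. by case: x => [[[A B] f]|] //; rewrite -!/(arr _) !ascaleE scalerA. Qed.

Lemma ptr_eq1 (A B : C) (f : mor A A) (g : mor B B) :
  atr A (arr f) = atr B (arr g) -> ptr f = ptr g.
Proof. by move=> e; rewrite -[ptr g]mul1r; apply: ptr_eq; rewrite ascale1. Qed.

Lemma ptr_linear (V : C) : linear (@ptr F C V : mor V V -> F^o).
Proof.
move=> a f g; rewrite /ptr comp_linearr tensm_linearl comp_linearr comp_linearl.
exact: escalar_linear.
Qed.

Lemma ptrZ (V : C) a (f : mor V V) : ptr (a *: f) = a * ptr f.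
Proof. exact: (linear_scale _ _ (@ptr_linear V)). Qed.

Lemma ptr_sum (V : C) (I : Type) (r : seq I) (P : pred I) (f : I -> mor V V) :
  ptr (\sum_(i <- r | P i) f i) = \sum_(i <- r | P i) ptr (f i).
Proof. exact: (linear_bigsum _ _ _ (@ptr_linear V)). Qed.

Lemma ptr_cyclic (A B : C) (x : mor B A) (y : mor A B) :
  ptr (x ∘ y) = ptr (y ∘ x).
Proof.
apply: ptr_eq1; rewrite -!acompE.
exact: (atr_cyclic sC (typed_arr x) (typed_arr y)).
Qed.

Lemma pdim_iso (A B : C) : isomorphic A B -> pdim A = pdim B.
Proof. by move=> [f [g [gf fg]]]; rewrite /pdim -gf ptr_cyclic fg. Qed.

Lemma pdim1 : pdim (tunit : C) = 1.
Proof.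
have := ptrP (idm (tunit : C)); rewrite -/(aid _) (atr1 sC) -[aid _]ascale1.
rewrite ascaleE => /arr_inj; exact: scale_vec_inj (simple_idm_neq0 simple1).
Qed.

Lemma pdim_tens (A V : C) : pdim (A ⊗ V) = pdim A * pdim V.
Proof.
rewrite mulrC; apply: ptr_eq; rewrite -/(aid _) (atr_tens sC); last first.
  exact: typed_arr.
rewrite (apt_aid sC) -[atr V _]ptrP -ascaleE atensZr (atens1r _); last by case: sC.
by rewrite atrZ.
Qed.

Lemma pdim_dual (V : C) : pdim V^∨ = pdim V.
Proof. by apply: ptr_eq1; exact: (atr_dual sC). Qed.

Definition dbr (V W : C) : mor (V ⊗ W) (V ⊗ W) := braid W V ∘ braid V W.

Lemma arr_dbr (V W : C) : arr (dbr V W) = adbr V W.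
Proof. by rewrite -acompE. Qed.

Lemma dbr_nat (V V' W W' : C) (f : mor V V') (g : mor W W') :
  dbr V' W' ∘ (f ⊗m g) = (f ⊗m g) ∘ dbr V W.
Proof.
by rewrite /dbr -Defs.compA braid_nat Defs.compA braid_nat Defs.compA.
Qed.

Lemma ptr_dbr_sym (V W : C) : ptr (dbr V W) = ptr (dbr W V).
Proof. exact: ptr_cyclic. Qed.

Lemma ptr_dbr1 (V : C) : ptr (dbr tunit V) = pdim V.
Proof.
have -> : dbr tunit V = idm (tunit ⊗ V).
  apply: arr_inj; rewrite arr_dbr (adbr1 sC) -/(aid _) otens1l //.
  by case: sC.
by rewrite -/(pdim _) pdim_tens pdim1 mul1r.
Qed.

Lemma ptr_dbr_isol (A B V : C) : isomorphic A B -> ptr (dbr A V) = ptr (dbr B V).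
Proof.
move=> [f [g [gf fg]]].
rewrite -[dbr A V]comp1m -tensm1 -gf -[idm V]comp1m tensm_comp -Defs.compA.
rewrite ptr_cyclic -dbr_nat -Defs.compA -tensm_comp fg comp1m tensm1.
by rewrite compm1.
Qed.

Section Simples.
Variables (Γ : finType) (X : Γ -> C).
Hypothesis simplesX : complete_simples X.

Let endX i (f : mor (X i) (X i)) : f = escalar f *: idm (X i).
Proof. exact: (endX simplesX dim1). Qed.

Let escalar1 i : escalar (idm (X i)) = 1.
Proof. by rewrite -[idm _]scale1r (escalarX simplesX dim1). Qed.

Section OneFrame.
Variables (A : C) (n : nat) (κ : 'I_n -> Γ).
Variables (u : forall a, mor (X (κ a)) A) (p : forall a, mor A (X (κ a))).
Hypothesis up : frame u p.

Lemma ptr_frame (f : mor A A) :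
  ptr f = \sum_a escalar (p a ∘ (f ∘ u a)) * pdim (X (κ a)).
Proof.
rewrite {1}(frame_pre up f) ptr_sum; apply: eq_bigr => a _.
by rewrite ptr_cyclic {1}[p a ∘ _]endX ptrZ.
Qed.

Lemma pdim_frame : pdim A = \sum_a pdim (X (κ a)).
Proof.
rewrite /pdim {1}ptr_frame; apply: eq_bigr => a _.
by case: up => pu _ _; rewrite comp1m pu escalar1 mul1r.
Qed.

(** Naturality carries [p a] through the double braiding and cyclicity carries it around the
    closure, leaving an endomorphism of [X (κ a)]. *)
Lemma ptr_dbr_frame (Y : C) (f : mor A A) :
  ptr ((idm Y ⊗m f) ∘ dbr Y A) =
  \sum_a escalar (p a ∘ (f ∘ u a)) * ptr (dbr Y (X (κ a))).
Proof.
rewrite {1}(frame_pre up f) tens_sumr comp_suml ptr_sum; apply: eq_bigr => a _.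
rewrite -[idm Y]comp1m tensm_comp -Defs.compA -dbr_nat Defs.compA ptr_cyclic.
rewrite Defs.compA -tensm_comp comp1m {1}[p a ∘ _]endX tensZr tensm1.
by rewrite compZl comp1m ptrZ.
Qed.

End OneFrame.

Lemma sum_pdim (A : C) :
  \sum_i (\dim {: mor (X i) A})%:R * pdim (X i) = pdim A.
Proof.
have [n [κ [u [p up]]]] := frame_exists ssC simplesX A.
by rewrite -(sum_frame abelC simplesX dim1 up) (pdim_frame up).
Qed.

Lemma sum_ptr_dbr (Y A : C) :
  \sum_i (\dim {: mor (X i) A})%:R * ptr (dbr Y (X i)) = ptr (dbr Y A).
Proof.
have [n [κ [u [p up]]]] := frame_exists ssC simplesX A.
rewrite -(sum_frame abelC simplesX dim1 up).
rewrite -[dbr Y A]comp1m -tensm1 (ptr_dbr_frame up); apply: eq_bigr => a _.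
by case: up => pu _ _; rewrite comp1m pu escalar1 mul1r.
Qed.

(** * Characters of the fusion ring and the non-singular S-matrix *)

Section Modular.
Hypothesis S_unit : S_matrix X \in unitmx.

Let s i k := ptr (dbr (X i) (X k)).

Lemma S_injective (g : Γ -> F) :
  (forall k, \sum_i g i * s i k = 0) -> forall i, g i = 0.
Proof.
move=> gS i; pose v := \row_a g (enum_val a) : 'rV_#|Γ|.
have vS : v *m S_matrix X = 0.
  apply/rowP => b; rewrite !mxE -[RHS](gS (enum_val b)).
  rewrite [RHS](big_enum_val (fun i => g i * s i (enum_val b))) /=.
  by apply: eq_bigr => a _; rewrite !mxE.
have v0 : v = 0 by rewrite -[v](mulmxK S_unit) vS mul0mx.
have := congr1 (fun w : 'rV_#|Γ| => w 0 (enum_rank i)) v0.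
by rewrite !mxE enum_rankK.
Qed.

Lemma sum_delta (k : Γ) (g : Γ -> F) : \sum_i (i == k)%:R * g i = g k.
Proof.
rewrite (bigD1 k) //= eqxx mul1r big1 ?addr0 // => i /negbTE ->.
by rewrite mul0r.
Qed.

(* χ_k(Y) = s_{k,Y} / d_k; the value 0 for an empty predicate never occurs. *)
Definition chi (k : Γ) (Y : C) : F :=
  xget 0 [set c | apt (X k) Y (adbr (X k) Y) = ascale c (aid (X k))]%classic.

Lemma chiP (k : Γ) (Y : C) :
  apt (X k) Y (adbr (X k) Y) = ascale (chi k Y) (aid (X k)).
Proof.
apply: (@xgetPex _ 0 [set c | apt (X k) Y (adbr (X k) Y) = ascale c (aid (X k))]%classic).
have [f e] := typed_apt sC (typed_adbr (X k) Y).
by exists (escalar f); rewrite /= e {1}[f]endX.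
Qed.

Lemma ptr_dbr_chi (k : Γ) (Y : C) : ptr (dbr (X k) Y) = chi k Y * pdim (X k).
Proof.
apply: ptr_eq; rewrite arr_dbr (atr_tens sC); last exact: typed_adbr.
by rewrite chiP atrZ.
Qed.

Lemma chi_tens (k : Γ) (Y Z : C) : chi k (Y ⊗ Z) = chi k Y * chi k Z.
Proof.
have := chiP k (Y ⊗ Z); rewrite (apt_adbr_tens sC) chiP.
rewrite atensZr aid_tens acompZr acompZl aptZ.
have -> : abr Y (X k) • aid (Y ⊗ X k) • abr (X k) Y = adbr (X k) Y.
  by rewrite (acomp1r (typed_abr _ _)).
rewrite chiP ascaleA !ascaleE => /arr_inj /(scale_vec_inj (idX_neq0 simplesX k)) <-.
by rewrite mulrC.
Qed.

(** Row [k] of the S-matrix is a multiple of [pdim (X k)], so it would vanish. *)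
Lemma pdimX_neq0 (k : Γ) : pdim (X k) != 0.
Proof.
apply/eqP => dk0.
have := @S_injective (fun i => (i == k)%:R) _ k.
rewrite eqxx => /(_ _)/eqP; rewrite oner_eq0 => h; apply: notF; apply: h => l.
by rewrite sum_delta /s ptr_dbr_chi dk0 mulr0.
Qed.

Lemma sum_chi (k : Γ) (A : C) :
  \sum_i (\dim {: mor (X i) A})%:R * chi k (X i) = chi k A.
Proof.
apply: (mulIf (pdimX_neq0 k)); rewrite -ptr_dbr_chi -sum_ptr_dbr mulr_suml.
by apply: eq_bigr => i _; rewrite ptr_dbr_chi mulrA.
Qed.

(** By Frobenius reciprocity the coefficients are the multiplicities of [X i] in [X m ⊗ (X l)^∨]. *)
Lemma sum_fusion_pdim (l m : Γ) :
  \sum_i (\dim {: mor (X i ⊗ X l) (X m)})%:R * pdim (X i) =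
  pdim (X m) * pdim (X l).
Proof.
rewrite -[pdim (X l)](pdim_dual) -pdim_tens -(sum_pdim (X m ⊗ (X l)^∨)).
by apply: eq_bigr => i _; rewrite (dim_hom_tens sC).
Qed.

Variable i0 : Γ.
Hypothesis iso1 : isomorphic (tunit : C) (X i0).

Lemma pdim_unit : pdim (X i0) = 1.
Proof. by rewrite -(pdim_iso iso1) pdim1. Qed.

Lemma ptr_dbr_unit (l : Γ) : s i0 l = pdim (X l).
Proof. by rewrite /s -(ptr_dbr_isol _ iso1) ptr_dbr1. Qed.

(* [a := Σ d_i χ_k(i)] satisfies [a χ_k(l) = a d_l] because [χ_k] and [d] are
   both characters of the fusion ring; non-singularity of S separates [χ_k]
   from [d] when [k] is not the unit. *)
Lemma kirby_color (k : Γ) :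
  \sum_i pdim (X i) * s i k = if k == i0 then global_dim X else 0.
Proof.
case: eqP => [->|/eqP ki0].
  apply: eq_bigr => i _; rewrite /s ptr_dbr_sym -/(s _ _) ptr_dbr_unit //.
pose a := \sum_i pdim (X i) * chi k (X i).
have ea : \sum_i pdim (X i) * s i k = a * pdim (X k).
  rewrite mulr_suml; apply: eq_bigr => i _.
  by rewrite /s ptr_dbr_sym ptr_dbr_chi mulrA.
rewrite ea; suff -> : a = 0 by rewrite mul0r.
apply/eqP/negP => /negP a0.
have chi_d l : chi k (X l) = pdim (X l).
  apply: (mulfI a0); rewrite {1}/a mulr_suml.
  under eq_bigr => i _ do rewrite -mulrA -chi_tens -sum_chi mulr_sumr.
  rewrite exchange_big /= mulr_suml; apply: eq_bigr => m _.
  rewrite mulrAC -sum_fusion_pdim mulr_suml; apply: eq_bigr => i _.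
  rewrite (dim_hom_sym abelC ssC simplesX dim1) mulrA; congr (_ * _).
  exact: mulrC.
(* Row [k] of the S-matrix minus [pdim (X k)] times the unit row: zero by [chi_d], yet with
   coefficient 1 at [k]. *)
have := @S_injective (fun i => (i == k)%:R - (i == i0)%:R * pdim (X k)) _ k.
rewrite eqxx (negbTE ki0) mul0r subr0 => /(_ _)/eqP; rewrite oner_eq0 => h.
apply: notF; apply: h => l; under eq_bigr => i _ do rewrite mulrBl -mulrA.
rewrite sumrB (sum_delta k (fun i => s i l)) (sum_delta i0 (fun i => _ * s i l)).
by rewrite ptr_dbr_unit /s ptr_dbr_chi chi_d mulrC subrr.
Qed.

(** Otherwise, by [kirby_color], the S-matrix would kill the vector of dimensions, whose unit entry
    is 1. *)
Lemma global_dim_neq0 : global_dim X != 0.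
Proof.
apply/eqP => dim0.
have := @S_injective (fun i => pdim (X i)) _ i0.
rewrite pdim_unit => /(_ _)/eqP; rewrite oner_eq0 => h.
by apply: notF; apply: h => k; rewrite kirby_color dim0; case: ifP.
Qed.

(* A loop coloured by [Σ d_i X_i] around [A] projects onto the unit isotypic
   component. *)
Lemma lin_trace_kirby (A : C) (B : mor A A)
    (E : {linear mor (tunit : C) A -> mor tunit A}) :
  (forall f, E f = B ∘ f) ->
  \sum_i pdim (X i) * ptr ((idm (X i) ⊗m B) ∘ dbr (X i) A) =
  global_dim X * lin_trace E.
Proof.
move=> EB; have [n [κ [u [p up]]]] := frame_exists ssC simplesX A.
rewrite (lin_trace_post abelC simplesX dim1 up iso1 EB) mulr_sumr.
under eq_bigr => i _ do rewrite (ptr_dbr_frame up) mulr_sumr.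
rewrite exchange_big /= [RHS]big_mkcond; apply: eq_bigr => a _.
transitivity (escalar (p a ∘ (B ∘ u a)) * \sum_i pdim (X i) * s i (κ a)).
  by rewrite mulr_sumr; apply: eq_bigr => i _; rewrite mulrCA.
by rewrite kirby_color mulrC; case: ifP; rewrite ?mul0r.
Qed.

(** Endomorphisms of [(X i)^∨] are scalars, so the nonzero idempotent [u ∘ p] of a summand is the
    identity and the dual is that summand. *)
Lemma dual_simple (i : Γ) : exists k, isomorphic (X i)^∨ (X k).
Proof.
have id0 : idm (X i)^∨ != 0.
  apply: contraNneq (idX_neq0 simplesX i) => e; apply/eqP.
  apply: (dualm_inj sC); rewrite (dualm_id sC) e.
  by rewrite (linear_zero (@dualm_linear _ _ _ _)).
have d1 : \dim {: mor (X i)^∨ (X i)^∨} = 1%N.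
  by rewrite (dim_hom_dual sC) dim1 //; apply: simpleX.
have [[|n] [κ [u [p [pu _ upE]]]]] := frame_exists ssC simplesX (X i)^∨.
  by case/eqP: id0; rewrite -upE big_ord0.
exists (κ ord0), (p ord0), (u ord0); split; last exact: pu.
have e := escalarE (u ord0 ∘ p ord0) id0 d1; set c := escalar _ in e.
have ec : c *: p ord0 = p ord0.
  by rewrite -[in RHS](comp1m (p ord0)) -pu -Defs.compA e compZr compm1.
have p0 : p ord0 != 0.
  apply: contraNneq (idX_neq0 simplesX (κ ord0)) => p0.
  by rewrite -pu p0 comp0l.
have c1 : c = 1 by apply: (scale_vec_inj p0); rewrite ec scale1r.
by rewrite e c1 scale1r.
Qed.

(** If [star i = star k], transposition gives a nonzero space [mor (X k) (X i)], and Schur gives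
    [i = k]. *)
Lemma dual_bijection : exists2 star : Γ -> Γ, injective star &
  forall i, isomorphic (X i)^∨ (X (star i)).
Proof.
have /boolp.choice [star hs] := dual_simple.
exists star => // i k e.
have : (\dim {: mor (X k) (X i)} != 0)%N.
  rewrite -(dim_hom_dual sC) (dim_hom_isol _ (hs i)) (dim_hom_isor _ (hs k)) e.
  by rewrite dim1 //; apply: simpleX.
apply: contraNeq => ik; rewrite dimv_eq0 -subv0; apply/subvP => f _.
by rewrite [f](homX_neq abelC simplesX) ?mem0v // eq_sym.
Qed.

(** * Twist eigenvalues and the indicator formula *)

Variable ω : Γ -> F.
Hypothesis twistX : forall i, twist (X i) = ω i *: idm (X i).

Lemma omega_neq0 i : ω i != 0.
Proof.
apply/eqP => w0; have [t [e _]] := twist_iso (X i).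
by have /eqP[] := idX_neq0 simplesX i; rewrite -e twistX w0 scale0r comp0r.
Qed.

Lemma twist_dual_scalar i : twist (X i)^∨ = ω i *: idm (X i)^∨.
Proof.
rewrite twist_dual twistX (linear_scale _ _ (@dualm_linear _ _ _ _)).
by rewrite (dualm_id sC).
Qed.

Lemma twist_iso_scalar (A B : C) (c : F) : isomorphic A B ->
  twist A = c *: idm A -> twist B = c *: idm B.
Proof.
move=> [f [g [_ fg]]] e.
by rewrite -[twist B]compm1 -fg Defs.compA twist_nat e compZr compZl compm1.
Qed.

(** The factor [tpow_shift] is an identity arrow by strictness; it makes the braid an endomorphism
    in the typed sense, so that its trace can be taken. *)
Definition rotation_mor (V : C) m : mor (tpow V m.+1) (tpow V m.+1) :=
  tpow_shift V m ∘ (braid V (tpow V m) ∘ (twist V ⊗m idm (tpow V m))).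

Lemma arr_rotation_mor (V : C) m : arr (rotation_mor V m) = arots V m.
Proof.
have e : arr (braid V (tpow V m) ∘ (twist V ⊗m idm (tpow V m))) = arots V m.
  by rewrite -acompE -atensE.
rewrite /rotation_mor -acompE (arr_tpow_shift sC) e -(tpow_comm sC).
apply: (acomp1l (A := V ⊗ tpow V m)); rewrite -e; exact: typed_arr.
Qed.

Lemma FS_operator_rotation (V : C) m (f : mor tunit (tpow V m.+1)) :
  FS_operator f = rotation_mor V m ∘ f.
Proof.
by apply: arr_inj; rewrite (arr_FS_operator sC) -acompE arr_rotation_mor.
Qed.

Definition rot (i j : Γ) : mor (X i ⊗ X j) (X i ⊗ X j) :=
  (idm (X i) ⊗m twist (X j)) ∘ dbr (X i) (X j).

Lemma ptr_rotation i j m :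
  ptr ((idm (X i) ⊗m rotation_mor (X j) m) ∘ dbr (X i) (tpow (X j) m.+1)) =
  ptr (iter m (mcomp (rot i j)) (rot i j)).
Proof.
apply: ptr_eq1.
have e : arr (rot i j) = arot (X i) (X j) by rewrite -acompE -atensE arr_dbr.
have -> : arr (iter m (mcomp (rot i j)) (rot i j)) =
    aiter (arot (X i) (X j)) m (arot (X i) (X j)).
  by elim: m => //= m IH; rewrite -acompE IH e.
rewrite -(atr_arots sC) -acompE -atensE arr_rotation_mor arr_dbr.
by [].
Qed.

Lemma twist_rot i j : twist (X i ⊗ X j) = ω i *: rot i j.
Proof. by rewrite twist_tens twistX tensZl compZl. Qed.

Lemma ptr_iter_rot i j m :
  ptr (iter m (mcomp (rot i j)) (rot i j)) =
  \sum_k (\dim {: mor (X k) (X i ⊗ X j)})%:R *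
    ((ω k / ω i) ^+ m.+1 * pdim (X k)).
Proof.
have [n [κ [u [p up]]]] := frame_exists ssC simplesX (X i ⊗ X j).
rewrite -(sum_frame abelC simplesX dim1 up
  (fun k => (ω k / ω i) ^+ m.+1 * pdim (X k))) (ptr_frame up).
apply: eq_bigr => a _; congr (_ * _).
have e : rot i j ∘ u a = (ω (κ a) / ω i) *: u a.
  have := twist_nat (u a); rewrite twist_rot twistX compZl compZr compm1 => h.
  by rewrite mulrC -scalerA -h scalerA mulVf ?omega_neq0 // scale1r.
(* The iteration starts at [rot i j] and not at the identity, hence the exponent [m.+1]. *)
have -> : iter m (mcomp (rot i j)) (rot i j) ∘ u a = (ω (κ a) / ω i) ^+ m.+1 *: u a.
  elim: m => [|m IH]; first by rewrite expr1 /= e.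
  by rewrite iterS -Defs.compA IH compZr e scalerA -exprSr.
by case: up => pu _ _; rewrite compZr pu (escalarX simplesX dim1).
Qed.

Lemma dim_hom_star (star : Γ -> Γ) i j k :
  (forall i, isomorphic (X i)^∨ (X (star i))) ->
  \dim {: mor (X i ⊗ X (star k)) (X j)} = \dim {: mor (X i) (X k ⊗ X j)}.
Proof.
move=> hs; have [f [g [gf fg]]] := hs k.
have iso : isomorphic (X i ⊗ (X k)^∨) (X i ⊗ X (star k)).
  exists (idm _ ⊗m f), (idm _ ⊗m g).
  by split; rewrite -tensm_comp comp1m ?gf ?fg tensm1.
rewrite -(dim_hom_isol _ iso) (dim_hom_tens sC) (odual_dual sC).
exact: dim_hom_isor (braid_isomorphic _ _).
Qed.

Lemma FS_indicatorE (j : Γ) (n : nat) : (0 < n)%N ->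
  FS_indicator (X j) n =
  (global_dim X)^-1 *
    \sum_i \sum_k
      (\dim {: mor (X i ⊗ X k) (X j)})%:R * pdim (X i) * pdim (X k) *
        (ω i / ω k) ^+ n.
Proof.
case: n => // m _; apply: (mulfI global_dim_neq0).
rewrite mulrA mulfV ?global_dim_neq0 // mul1r.
rewrite -(lin_trace_kirby (@FS_operator_rotation (X j) m)).
have [star star_inj hs] := dual_bijection.
(* The loop colour [i] on the left matches the second index [star i] on the right, and
   [dim_hom_star] matches the multiplicities. *)
rewrite [RHS]exchange_big /= [RHS](reindex_inj star_inj) /=.
apply: eq_bigr => i _; rewrite ptr_rotation ptr_iter_rot mulr_sumr.
apply: eq_bigr => k _; rewrite (dim_hom_star _ _ _ hs).
rewrite -(pdim_iso (hs i)) pdim_dual.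
have -> : ω (star i) = ω i.
  have := twist_iso_scalar (hs i) (twist_dual_scalar i); rewrite twistX.
  exact: scale_vec_inj (idX_neq0 simplesX _).
by rewrite mulrC -!mulrA; congr (_ * _); rewrite mulrC -!mulrA.
Qed.

(** * Indicators at the exponent *)

Lemma endpow_eigen (A B : C) (g : mor A A) (f : mor A B) (c : F) N :
  f ∘ g = c *: f -> f ∘ endpow g N = c ^+ N *: f.
Proof.
move=> e; elim: N => [|N IH]; first by rewrite /endpow /= compm1 expr0 scale1r.
by rewrite /endpow iterS -/(endpow _ _) Defs.compA e compZl IH scalerA exprS.
Qed.

(** The canonical embedding of a braided category into its center brings the double braidings of [C]
    under [kills_double_braidings]. *)
Definition center_of (A : C) : center_object C :=
  @CenterObject F C A (braid A) (braid_iso A)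
    (fun V W f => braid_nat (idm A) f) (hexagonr A).

(** By balancing and naturality of the twist along [f], the double braiding acts on [f] by
    [d / (a * b)], whose power [N] is therefore 1. *)
Lemma double_braiding_power (N : nat) (A B D : C) (a b d : F) (f : mor (A ⊗ B) D) :
  kills_double_braidings C N -> f != 0 -> a != 0 -> b != 0 ->
  twist A = a *: idm A -> twist B = b *: idm B -> twist D = d *: idm D ->
  d ^+ N = a ^+ N * b ^+ N.
Proof.
move=> kN f0 a0 b0 tA tB tD.
have e : f ∘ dbr A B = (d / (a * b)) *: f.
  have := twist_nat f; rewrite twist_tens tA tB tD tensZl tensZr tensm1 scalerA.
  rewrite !compZl !comp1m compZr => h.
  by rewrite mulrC -scalerA h scalerA mulVf ?mulf_neq0 // scale1r.
have := endpow_eigen N e.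
rewrite [endpow _ N](kN (center_of A) (center_of B)) compm1 -{1}[f]scale1r.
move/(scale_vec_inj f0) => h; rewrite expr_div_n exprMn in h.
have ab0 : a ^+ N * b ^+ N != 0 by rewrite mulf_neq0 // expf_neq0.
by apply: (mulIf (invr_neq0 ab0)); rewrite mulfV.
Qed.

Lemma ev_neq0 i : ev (X i) != 0.
Proof.
apply: contraNneq (idX_neq0 simplesX i) => e.
rewrite -zigzag e (linear_zero (@tensm_linearr _ _ _ _ _ _ _)).
by rewrite comp0r !comp0l.
Qed.

Lemma twist1 : twist (tunit : C) = 1 *: idm (tunit : C).
Proof. by apply: arr_inj; rewrite scale1r; exact: (atw1 sC). Qed.

Lemma omega_exponent (N : nat) (i : Γ) : kills_double_braidings C N ->
  (ω i ^+ N) ^+ 2 = 1.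
Proof.
move=> kN; rewrite expr2.
rewrite -(double_braiding_power kN (ev_neq0 i) (omega_neq0 i) (omega_neq0 i)
  (twist_dual_scalar i) (twistX i) twist1).
by rewrite expr1n.
Qed.

Lemma FS_indicator_exponent (N : nat) (j : Γ) :
  (0 < N)%N -> kills_double_braidings C N ->
  FS_indicator (X j) N = ω j ^+ N * pdim (X j).
Proof.
move=> N0 kN; rewrite FS_indicatorE //; apply: (mulfI global_dim_neq0).
rewrite mulrA mulfV ?global_dim_neq0 // mul1r.
transitivity (\sum_i \sum_k (\dim {: mor (X i ⊗ X k) (X j)})%:R * pdim (X i) *
    (pdim (X k) * ω j ^+ N)).
  apply: eq_bigr => i _; apply: eq_bigr => k _.
  have [->|d0] := eqVneq (\dim {: mor (X i ⊗ X k) (X j)}) 0%N.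
    by rewrite !mul0r.
  have [f f0] : exists f : mor (X i ⊗ X k) (X j), f != 0.
    apply: contrapT => h; move/negP: d0; apply; rewrite dimv_eq0 -subv0.
    apply/subvP => f _; have [->|f0] := eqVneq f 0; first exact: mem0v.
    by case: h; exists f.
  rewrite (double_braiding_power kN f0 (omega_neq0 i) (omega_neq0 k) (twistX i)
    (twistX k) (twistX j)) -!mulrA; do 3!congr (_ * _).
  rewrite expr_div_n; congr (_ * _).
  (* [ω k ^+ N] squares to 1, so it is its own inverse. *)
  have wk : ω k ^+ N != 0 by rewrite expf_neq0 ?omega_neq0.
  by apply: (mulfI wk); rewrite mulfV // -expr2 omega_exponent.
(* Summing over [i] first gives [pdim (X j) * pdim (X k)] by [sum_fusion_pdim]; the sum over [k] is
   then the global dimension. *)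
rewrite exchange_big /= mulrC /global_dim mulr_sumr; apply: eq_bigr => k _.
by rewrite -mulr_suml sum_fusion_pdim expr2 !mulrA [LHS]mulrC !mulrA.
Qed.

End Modular.

End Simples.
End Traces.

Theorem theorem7p5 (R : realType) (C : ribbon_category R[i])
  (C_modular : modular C) (C_strict : strict_category C)
  (Γ : finType) (X : Γ -> C) (X_simples : complete_simples X)
  (ω : Γ -> R[i])
  (ω_twist : forall i : Γ, twist (X i) = ω i *: idm (X i)) :
  (forall (j : Γ) (n : nat), (0 < n)%N ->
     FS_indicator (X j) n =
     (global_dim X)^-1 *
       \sum_(i : Γ) \sum_(k : Γ)
          (\dim {: mor (X i ⊗ X k) (X j)})%:R * pdim (X i) * pdim (X k) *
            (ω i / ω k) ^+ n) /\
  (forall N : nat, is_exponent C N ->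
     forall j : Γ,
       FS_indicator (X j) N = ω j ^+ N * pdim (X j) /\
       (ω j ^+ N * pdim (X j) = pdim (X j) \/
        ω j ^+ N * pdim (X j) = - pdim (X j))).
Proof.
have [fusC S_unit] := C_modular.
have simple1 : simple (tunit : C) by case: fusC.
have [i0 iso1] : exists i, isomorphic (tunit : C) (X i).
  by case: X_simples => _ _; apply.
have SX := S_unit Γ X X_simples.
split=> [j n n0|N [N0 kN _] j].
  exact: (FS_indicatorE C_strict fusC X_simples SX iso1 ω_twist).
split.
  exact: (FS_indicator_exponent C_strict fusC X_simples SX iso1 ω_twist).
have /eqP := omega_exponent C_strict X_simples ω_twist j kN.
rewrite sqrf_eq1 => /orP[] /eqP ->; first by left; rewrite mul1r.
by right; rewrite mulN1r.
Qed.
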